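(* Let $K_1$ be a class of finite structures of some finite relational vocabulary $\tau_1$, and let $\mathcal{L}$ be an arbitrary countable subset of $L^{\omega}_{\infty\omega}$. Let $\tau_2$ be the extension of $\tau_1$ by a new binary predicate $P$. Then there exists a class $K_2$ of finite $\tau_2$-structures such that: (1) $K_1$ is precisely the class of $\tau_1$-reducts of the induced substructures $M_2\restriction\{x\mid M_2\models P(x,x)\}$, where $M_2$ ranges over $K_2$; and (2) every formula of $\mathcal{L}$ (in vocabulary contained in $\tau_2$) is equivalent on $K_2$ to a first-order formula.
   Context: Classes of structures are closed under isomorphism. $L^{\omega}_{\infty\omega}$ is the extension of first-order logic allowing conjunctions and disjunctions of arbitrary sets of formulas, provided the total number of distinct individual variables (free or bound) in the resulting formula is finite; each formula uses a finite vocabulary. A formula $\psi$ is equivalent on a class $K$ to $\chi$ if for every $M\in K$ and tuple $\bar a$ of elements of $M$, $M\models\psi(\bar a)\iff M\models\chi(\bar a)$. *)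

(* Defs.v *)
From mathcomp Require Import all_boot.
From mathcomp Require Import boolp classical_sets functions cardinality.

Set Implicit Arguments.
Unset Strict Implicit.
Unset Printing Implicit Defensive.

Record vocabulary := Vocabulary {
  symbol :> finType;
  arity : symbol -> nat
}.

(* The record allows an empty universe, so that every induced substructure is a
   [structure]; non-emptiness is part of [structure_class] below. *)
Record structure (tau : vocabulary) := Structure {
  universe :> finType;
  interp : forall R : tau, (arity R).-tuple universe -> bool
}.
Arguments interp {tau} _ R _.

Definition isomorphic (tau : vocabulary) (M N : structure tau) : Prop :=
  exists f : M -> N, bijective f /\
    forall (R : tau) (t : (arity R).-tuple M),
      interp N R (map_tuple f t) = interp M R t.

(* The usual convention: the structures of a class have non-empty universes. *)
Definition structure_class (tau : vocabulary) (K : structure tau -> Prop) : Prop :=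
  (forall M, K M -> 0 < #|M|) /\
  (forall M N, isomorphic M N -> K M -> K N).

Definition substructure (tau : vocabulary) (M : structure tau) (A : {set M}) :
    structure tau :=
  @Structure tau {x : M | x \in A} (fun R t => interp M R (map_tuple val t)).

(* [None] is the new symbol P; [Some R] is the old symbol R. *)
Definition add_binary (tau : vocabulary) : vocabulary :=
  @Vocabulary (option tau) (fun s => if s is Some R then arity R else 2).

Definition holdsP (tau : vocabulary) (M : structure (add_binary tau)) (x y : M) :
    bool :=
  interp M (None : add_binary tau) [tuple x; y].

Definition reduct (tau : vocabulary) (M : structure (add_binary tau)) :
    structure tau :=
  @Structure tau M (fun R t => interp M (Some R : add_binary tau) t).

Inductive formula (tau : vocabulary) : Type :=
| FEq of nat & nat
| FRel (R : tau) of (arity R).-tuple nat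
| FNot of formula tau
| FAnd of formula tau & formula tau
| FOr of formula tau & formula tau
| FEx of nat & formula tau
| FAll of nat & formula tau
| FConj (J : Type) of J -> formula tau
| FDisj (J : Type) of J -> formula tau.

Fixpoint sat (tau : vocabulary) (M : structure tau) (phi : formula tau)
    (e : nat -> M) : Prop :=
  match phi with
  | FEq i j => e i = e j
  | FRel R t => interp M R (map_tuple e t)
  | FNot p => ~ sat p e
  | FAnd p q => sat p e /\ sat q e
  | FOr p q => sat p e \/ sat q e
  | FEx i p => exists x : M, sat p [eta e with i |-> x]
  | FAll i p => forall x : M, sat p [eta e with i |-> x]
  | FConj J f => forall i : J, sat (f i) e
  | FDisj J f => exists i : J, sat (f i) e
  end.

(* Free and bound occurrences alike. *)
Fixpoint occurs (tau : vocabulary) (v : nat) (phi : formula tau) : Prop :=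
  match phi with
  | FEq i j => v = i \/ v = j
  | FRel R t => v \in t
  | FNot p => occurs v p
  | FAnd p q | FOr p q => occurs v p \/ occurs v q
  | FEx i p | FAll i p => v = i \/ occurs v p
  | FConj J f | FDisj J f => exists i : J, occurs v (f i)
  end.

Definition finite_variable (tau : vocabulary) (phi : formula tau) : Prop :=
  finite_set [set v | occurs v phi].

Fixpoint first_order (tau : vocabulary) (phi : formula tau) : Prop :=
  match phi with
  | FEq _ _ | FRel _ _ => True
  | FNot p | FEx _ p | FAll _ p => first_order p
  | FAnd p q | FOr p q => first_order p /\ first_order q
  | FConj _ _ | FDisj _ _ => False
  end.

Definition equivalent_on (tau : vocabulary) (K : structure tau -> Prop)
    (psi chi : formula tau) : Prop :=
  forall M, K M -> forall e : nat -> M, sat psi e <-> sat chi e.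

(* Main.v *)
(**
  The structure attached to a structure [N] of [K1] is a finite tower: level 0 is
  [N], and every point of level [i + 1] has a parent of level [i].  Points of
  different levels are related by [P] as their ancestors in the lower of the two
  levels are, and inside a level [P] is a random digraph, apart from two hidden
  restrictions enforced by the pigeonhole principle.
  - Every point carries a shade, and mutual edges join different shades only.
  - For every set [Y] in a prescribed family of sets of parents, every point carries
    a mark, and one-way edges between points with parents in [Y] join different
    marks only.
  There are so many shades and marks that a formula with few variables cannot notice
  the restrictions, while a longer first-order formula can: it recognises the levels
  through the shades and reads the family off the marks.

  By a back-and-forth argument, the truth of a formula [phi n] at a tuple depends
  only on the ancestors of its elements in level [n] and on the pattern of [P] and
  [=] among the elements above that level.  It may therefore be evaluated at a tuple
  of level at most [n + 1], already in a truncation of the tower, and the level on top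
  of this truncation stores the result as the family of the sets [Y] at which [phi n]
  fails.  A tower
  of height [h] treats only finitely many formulas, so the heights must tend to
  infinity along the isomorphism types in [K1]; the finitely many towers that are
  too low for a given formula are handled by the fact that first-order logic defines
  everything on structures of bounded size.
*)

Require Import Defs.
From mathcomp Require Import all_boot.
From mathcomp Require Import zify.
From mathcomp Require Import boolp.

Set Implicit Arguments.
Unset Strict Implicit.
Unset Printing Implicit Defensive.

(** * Back-and-forth *)

(** Only variables in [V] are ever reassigned, so a system closed under these moves passes through
    conjunctions and disjunctions of any size. *)
Lemma sat_back_forth (tau : vocabulary) (M N : structure tau) (V : nat -> Prop)
    (R : (nat -> M) -> (nat -> N) -> Prop) :
  (forall e e', R e e' -> forall v w, V v -> V w -> e v = e w <-> e' v = e' w) ->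
  (forall e e', R e e' -> forall (S : tau) (t : (arity S).-tuple nat),
     (forall v, v \in t -> V v) ->
     interp M S (map_tuple e t) = interp N S (map_tuple e' t)) ->
  (forall e e', R e e' -> forall v x, V v ->
     exists y, R [eta e with v |-> x] [eta e' with v |-> y]) ->
  (forall e e', R e e' -> forall v y, V v ->
     exists x, R [eta e with v |-> x] [eta e' with v |-> y]) ->
  forall phi, (forall v, occurs v phi -> V v) ->
  forall e e', R e e' -> sat phi e <-> sat phi e'.
Proof.
move=> Req Rrel forth back; elim => /=.
- by move=> i j Vphi e e' Ree'; apply: Req Ree' _ _ _ _; apply: Vphi; [left|right].
- by move=> S t Vphi e e' Ree'; rewrite (Rrel _ _ Ree').
- by move=> p IH Vphi e e' /(IH Vphi) ->.
- move=> p IHp q IHq Vphi e e' Ree'.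
  rewrite (IHp _ _ _ Ree') ?(IHq _ _ _ Ree') //; move=> v vp; apply: Vphi; by [left|right].
- move=> p IHp q IHq Vphi e e' Ree'.
  rewrite (IHp _ _ _ Ree') ?(IHq _ _ _ Ree') //; move=> v vp; apply: Vphi; by [left|right].
- move=> i p IH Vphi e e' Ree'.
  have Vp v : occurs v p -> V v by move=> vp; apply: Vphi; right.
  have Vi : V i by apply: Vphi; left.
  split=> -[x px].
  + by have [y Ry] := forth _ _ Ree' i x Vi; exists y; apply/(IH Vp _ _ Ry).
  + by have [y Ry] := back _ _ Ree' i x Vi; exists y; apply/(IH Vp _ _ Ry).
- move=> i p IH Vphi e e' Ree'.
  have Vp v : occurs v p -> V v by move=> vp; apply: Vphi; right.
  have Vi : V i by apply: Vphi; left.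
  split=> px x.
  + by have [y Ry] := back _ _ Ree' i x Vi; apply/(IH Vp _ _ Ry).
  + by have [y Ry] := forth _ _ Ree' i x Vi; apply/(IH Vp _ _ Ry).
- move=> J F IH Vphi e e' Ree'.
  have Vp j v : occurs v (F j) -> V v by move=> vp; apply: Vphi; exists j.
  by split=> px j; apply/(IH j (Vp j) _ _ Ree').
- move=> J F IH Vphi e e' Ree'.
  have Vp j v : occurs v (F j) -> V v by move=> vp; apply: Vphi; exists j.
  by split=> -[j px]; exists j; apply/(IH j (Vp j) _ _ Ree').
Qed.

Lemma sat_local (tau : vocabulary) (M : structure tau) (phi : formula tau)
    (e e' : nat -> M) :
  (forall v, occurs v phi -> e v = e' v) -> sat phi e <-> sat phi e'.
Proof.
move=> ee'.
refine (@sat_back_forth tau M M (fun v => occurs v phi)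
  (fun e e' => forall v, occurs v phi -> e v = e' v) _ _ _ _ phi _ e e' ee') => //.
- by move=> f f' ff' v w vp wp; rewrite !ff'.
- move=> f f' ff' S t tV; congr interp; apply: val_inj => /=.
  by apply/eq_in_map => v /tV /ff'.
- by move=> f f' ff' v x _; exists x => w wp /=; case: eqP => // _; apply: ff'.
- by move=> f f' ff' v x _; exists x => w wp /=; case: eqP => // _; apply: ff'.
Qed.

Lemma sat_iso (tau : vocabulary) (M N : structure tau) (f : M -> N) :
  bijective f ->
  (forall (R : tau) (t : (arity R).-tuple M),
     interp N R (map_tuple f t) = interp M R t) ->
  forall phi e, sat phi e <-> sat phi (f \o e).
Proof.
move=> [g fK gK] fR phi e.
refine (@sat_back_forth tau M N (fun=> True) (fun e e' => forall v, e' v = f (e v))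
  _ _ _ _ phi _ e (f \o e) _) => //.
- by move=> a b ab v w _ _; rewrite !ab; split=> [->//|/(can_inj fK)].
- move=> a b ab S t _; rewrite -fR; congr interp; apply: val_inj => /=.
  by rewrite -map_comp; apply: eq_map => v; rewrite ab.
- by move=> a b ab v x _; exists (f x) => w /=; case: eqP.
- by move=> a b ab v y _; exists (g y) => w /=; case: eqP => [_|_]; rewrite ?gK.
Qed.

Lemma isomorphic_sym (tau : vocabulary) (M N : structure tau) :
  isomorphic M N -> isomorphic N M.
Proof.
move=> [f [[g fK gK] fR]]; exists g; split; first by exists f.
move=> R t; rewrite -fR; congr interp; apply: val_inj => /=.
by rewrite -map_comp -[RHS]map_id; apply: eq_map => v /=; rewrite gK.
Qed.

Lemma isomorphic_trans (tau : vocabulary) (M N O : structure tau) :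
  isomorphic M N -> isomorphic N O -> isomorphic M O.
Proof.
move=> [f [fbij fR]] [g [gbij gR]]; exists (g \o f).
split; first exact: bij_comp.
move=> R t; rewrite -fR -gR; congr interp; apply: val_inj => /=.
by rewrite -map_comp.
Qed.

Lemma first_order_conj (tau : vocabulary) (J : finType) (F : J -> formula tau) :
  (forall j, first_order (F j)) ->
  exists2 chi, first_order chi &
    forall (M : structure tau) (e : nat -> M), sat chi e <-> forall j, sat (F j) e.
Proof.
move=> FO; exists (foldr (@FAnd tau) (FEq tau 0 0) [seq F j | j <- enum J]).
  by elim: (enum J) => //= j s IH; split.
move=> M e.
have -> : sat (foldr (@FAnd tau) (FEq tau 0 0) [seq F j | j <- enum J]) e <->
    forall j, j \in enum J -> sat (F j) e.
  elim: (enum J) => [|j s IH] /=; first by split.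
  rewrite IH; split=> [[pj ps] i|ps].
    by rewrite inE => /predU1P[->|/ps].
  by split=> [|i si]; apply: ps; rewrite inE ?eqxx ?si ?orbT.
by split=> H j; [apply: H; rewrite mem_enum | move=> _; apply: H].
Qed.

Lemma first_order_disj (tau : vocabulary) (J : finType) (F : J -> formula tau) :
  (forall j, first_order (F j)) ->
  exists2 chi, first_order chi &
    forall (M : structure tau) (e : nat -> M), sat chi e <-> exists j, sat (F j) e.
Proof.
move=> FO; have [|chi chiFO chiE] := @first_order_conj tau J (fun j => FNot (F j)).
  by move=> j; apply: FO.
exists (FNot chi) => // M e.
change (~ sat chi e <-> exists j, sat (F j) e); rewrite chiE.
by split=> [/existsNP[j /contrapT Fj]|[j Fj] H]; [exists j | apply: H j Fj].
Qed.

(** * First-order definability over a family of structures *)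

Section Definability.
Variables (tau : vocabulary) (I : Type) (S : I -> structure tau).

(* Quantifying over all namings of the variables makes the notion closed under
   renaming without any substitution on formulas. *)
Definition definable (X : finType) (Q : forall i, (X -> S i) -> Prop) : Prop :=
  forall s : X -> nat, exists2 chi, first_order chi &
    forall i (e : nat -> S i), sat chi e <-> Q i (e \o s).

Section Closure.
Variable X : finType.
Implicit Types Q : forall i, (X -> S i) -> Prop.

Lemma definable_ext Q Q' :
  (forall i e, Q i e <-> Q' i e) -> definable Q -> definable Q'.
Proof.
by move=> QQ' dQ s; have [c cF cE] := dQ s; exists c => // i e; rewrite cE.
Qed.

Lemma definable_eq (x y : X) : definable (fun i e => e x = e y).
Proof. by move=> s; exists (FEq tau (s x) (s y)). Qed.

Lemma definable_rel (R : tau) (t : (arity R).-tuple X) :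
  definable (fun i e => interp (S i) R (map_tuple e t)).
Proof.
move=> s; exists (FRel (map_tuple s t)) => // i e /=.
suff -> : map_tuple e (map_tuple s t) = map_tuple (e \o s) t by [].
by apply: val_inj => /=; rewrite -map_comp.
Qed.

Lemma definable_not Q : definable Q -> definable (fun i e => ~ Q i e).
Proof.
move=> dQ s; have [c cF cE] := dQ s.
by exists (FNot c) => // i e /=; rewrite cE.
Qed.

Lemma definable_forall (J : finType) (Q : J -> forall i, (X -> S i) -> Prop) :
  (forall j, definable (Q j)) -> definable (fun i e => forall j, Q j i e).
Proof.
move=> dQ s.
have /choice[c cP] : forall j, exists c, first_order c /\
    forall i (e : nat -> S i), sat c e <-> Q j i (e \o s).
  by move=> j; have [c ? ?] := dQ j s; exists c.
have [j|d dF dE] := @first_order_conj tau J c; first by have [] := cP j.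
exists d => // i e; rewrite dE.
by split=> H j; apply/(cP j).2/H.
Qed.

Lemma definable_exists (J : finType) (Q : J -> forall i, (X -> S i) -> Prop) :
  (forall j, definable (Q j)) -> definable (fun i e => exists j, Q j i e).
Proof.
move=> dQ; apply: (@definable_ext (fun i e => ~ forall j, ~ Q j i e)).
  by move=> i e; split=> [/existsNP[j /contrapT Qj]|[j Qj] H]; [exists j | apply: H j Qj].
by apply/definable_not/definable_forall => j; apply: definable_not.
Qed.

Lemma definable_and Q Q' :
  definable Q -> definable Q' -> definable (fun i e => Q i e /\ Q' i e).
Proof.
move=> dQ dQ' s; have [c cF cE] := dQ s; have [d dF dE] := dQ' s.
by exists (FAnd c d) => // i e /=; rewrite cE dE.
Qed.

Lemma definable_or Q Q' :
  definable Q -> definable Q' -> definable (fun i e => Q i e \/ Q' i e).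
Proof.
move=> dQ dQ' s; have [c cF cE] := dQ s; have [d dF dE] := dQ' s.
by exists (FOr c d) => // i e /=; rewrite cE dE.
Qed.

Lemma definable_imp Q Q' :
  definable Q -> definable Q' -> definable (fun i e => Q i e -> Q' i e).
Proof.
move=> dQ dQ'; apply: (@definable_ext (fun i e => ~ Q i e \/ Q' i e)).
  by move=> i e; rewrite -implyE.
by apply: definable_or dQ'; apply: definable_not.
Qed.

Lemma definable_iff Q Q' :
  definable Q -> definable Q' -> definable (fun i e => Q i e <-> Q' i e).
Proof. by move=> dQ dQ'; apply: definable_and; apply: definable_imp. Qed.

Lemma definable_ex (Y : finType)
    (Q : forall i, (X -> S i) -> (Y -> S i) -> Prop) :
  @definable (X + Y)%type (fun i e => Q i (e \o inl) (e \o inr)) ->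
  definable (fun i e => exists d, Q i e d).
Proof.
(* Names from [w] on lie beyond the image of [s], so the quantified variables capture no free
   one. *)
move=> dQ s; pose w := (\max_x s x).+1.
pose s' (u : X + Y) := match u with inl x => s x | inr y => w + enum_rank y end.
have [c cF cE] := dQ s'.
exists (foldr (@FEx tau) c [seq s' (inr y) | y <- enum Y]).
  by elim: (enum Y).
move=> i e.
have -> : forall vs, sat (foldr (@FEx tau) c vs) e <->
    exists2 e' : nat -> S i, (forall v, v \notin vs -> e' v = e v) & sat c e'.
  move=> vs; elim: vs e => [|v vs IH] e /=.
    split=> [|[e' ee' ce']]; first by exists e.
    by apply/(sat_local _).1: ce' => v _; rewrite ee'.
  split=> [[x /IH[e' ee' ce']]|[e' ee' ce']].
    exists e' => // u; rewrite inE negb_or => /andP[uv uvs].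
    by rewrite ee' //= (negPf uv).
  exists (e' v); apply/IH; exists e' => // u uvs /=.
  by case: eqP => [->//|/eqP uv]; rewrite ee' // inE negb_or uv.
have winj y y' : (w + enum_rank y == w + enum_rank y') = (y == y').
  by rewrite eqn_add2l (inj_eq val_inj) (inj_eq enum_rank_inj).
split=> [[e' ee' /cE Qe']|[d Qd]].
  exists (e' \o s' \o inr).
  suff -> : e \o s = e' \o s' \o inl by [].
  apply: funext => x /=; rewrite ee' //; apply/mapP => -[y _] /= sx.
  by have := leq_bigmax (F := s) x; rewrite sx /w leqNgt ltn_addr.
pose e' v := if [pick y | s' (inr y) == v] is Some y then d y else e v.
exists e'.
  move=> v vs; rewrite /e'; case: pickP => // y /eqP yv.
  by case/mapP: vs; exists y; rewrite // mem_enum.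
apply/cE.
have -> : e' \o s' \o inl = e \o s.
  apply: funext => x /=; rewrite /e'; case: pickP => // y /= /eqP yv.
  by have := leq_bigmax (F := s) x; rewrite -yv /w leqNgt ltn_addr.
have -> // : e' \o s' \o inr = d.
apply: funext => y /=; rewrite /e'; case: pickP => [y' /=|/(_ y)/=].
  by rewrite winj => /eqP ->.
by rewrite eqxx.
Qed.

End Closure.

Lemma definable_all (X Y : finType)
    (Q : forall i, (X -> S i) -> (Y -> S i) -> Prop) :
  @definable (X + Y)%type (fun i e => Q i (e \o inl) (e \o inr)) ->
  definable (fun i e => forall d, Q i e d).
Proof.
move=> dQ; apply: (@definable_ext X (fun i e => ~ exists d, ~ Q i e d)).
  by move=> i e; split=> [/forallNP H d|H [d]]; [apply: contrapT (H d) | apply].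
apply: definable_not; apply: (@definable_ex X Y (fun i e d => ~ Q i e d)).
exact: definable_not.
Qed.

End Definability.

(** * Structures of bounded size *)

Definition code (tau : vocabulary) (n : nat) :=
  {dffun forall R : tau, {set (arity R).-tuple 'I_n}}.

Definition decode (tau : vocabulary) (n : nat) (c : code tau n) : structure tau :=
  @Structure tau 'I_n (fun R t => t \in c R).

Lemma isomorphic_decode (tau : vocabulary) (M : structure tau) :
  exists c : code tau #|M|, isomorphic (decode c) M.
Proof.
exists [ffun R => [set t | interp M R (map_tuple enum_val t)]].
exists enum_val; split; first exact: enum_val_bij.
by move=> R t /=; rewrite ffunE inE.
Qed.

(* On finite structures, agreement on the first-order formulas in given free
   variables is itself a back-and-forth system. *)
Definition agree (tau : vocabulary) (b : nat) (M N : structure tau)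
    (e : nat -> M) (e' : nat -> N) : Prop :=
  forall chi, first_order chi ->
    (forall (O : structure tau) (f g : nat -> O),
       (forall v, v <= b -> f v = g v) -> sat chi f <-> sat chi g) ->
    sat chi e <-> sat chi e'.

Lemma agree_sym (tau : vocabulary) (b : nat) (M N : structure tau)
    (e : nat -> M) (e' : nat -> N) : agree b e e' -> agree b e' e.
Proof. by move=> A chi chiF chiL; rewrite A. Qed.

(** If every [y] failed, each would be refuted by a formula true at [x]; as [N] is finite, the
    conjunction of these formulas, quantified existentially, would separate [e] from [e']. *)
Lemma agree_forth (tau : vocabulary) (b : nat) (M N : structure tau)
    (e : nat -> M) (e' : nat -> N) (v : nat) (x : M) :
  agree b e e' -> v <= b ->
  exists y, agree b [eta e with v |-> x] [eta e' with v |-> y].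
Proof.
move=> A vb; apply: contrapT => /forallNP noy.
have /choice[c cP] : forall y, exists c, [/\ first_order c,
    (forall (O : structure tau) (f g : nat -> O),
       (forall v, v <= b -> f v = g v) -> sat c f <-> sat c g),
    sat c [eta e with v |-> x] & ~ sat c [eta e' with v |-> y]].
  move=> y; have /existsNP[c] := noy y.
  move=> /not_implyP[cF /not_implyP[cL cN]].
  have [cx|cx] := pselect (sat c [eta e with v |-> x]).
    exists c; split => // cy; apply: cN; tauto.
  exists (FNot c); split => //=; last by apply/notP; apply: contrapT => cy; apply: cN; tauto.
  by move=> O f g fg; rewrite (cL _ _ _ fg).
have [y|d dF dE] := @first_order_conj tau N c; first by have [] := cP y.
have [] := A (FEx v d) dF.
- move=> O f g fg /=.
  have fgz z w : w <= b -> [eta f with v |-> z] w = [eta g with v |-> z] w.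
    by move=> wb /=; case: eqP => // _; apply: fg.
  have cfg z y : sat (c y) [eta f with v |-> z] <-> sat (c y) [eta g with v |-> z].
    by have [_ cL _ _] := cP y; apply: cL => w /fgz ->.
  split=> -[z dz]; exists z; apply/dE => y; first exact/(cfg z y).1/((dE _ _).1 dz).
  exact/(cfg z y).2/((dE _ _).1 dz).
- move=> /= + _; case.
    by exists x; apply/dE => y; have [] := cP y.
  by move=> y /dE/(_ y); have [] := cP y.
Qed.

Lemma agree_sat (tau : vocabulary) (b : nat) (M N : structure tau)
    (phi : formula tau) (e : nat -> M) (e' : nat -> N) :
  (forall v, occurs v phi -> v <= b) -> agree b e e' -> sat phi e <-> sat phi e'.
Proof.
move=> phib A0.
refine (@sat_back_forth tau M N (fun v => v <= b) (@agree tau b M N)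
  _ _ _ _ phi phib e e' A0).
- move=> f f' A v w vb wb; apply: (A (FEq tau v w)) => // O g h gh /=.
  by rewrite !gh.
- move=> f f' A R t tb.
  suff [AB BA] : sat (FRel t) f <-> sat (FRel t) f' by apply/idP/idP.
  apply: A => // O g h gh /=.
  suff -> : map_tuple g t = map_tuple h t by [].
  by apply: val_inj; apply/eq_in_map => v /tb /gh.
- by move=> f f' A v x vb; apply: agree_forth.
- move=> f f' /agree_sym A v y vb; have [x Ax] := agree_forth y A vb.
  by exists x; apply: agree_sym.
Qed.

(** Up to isomorphism and up to values at variables beyond [b], there are finitely many pairs of a
    structure and an assignment. By [agree_sat], two pairs on which [phi] differs are separated by a
    first-order formula; [chi] is a disjunction of conjunctions of such formulas. *)
Lemma first_order_bounded (tau : vocabulary) (phi : formula tau) (b s : nat) :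
  (forall v, occurs v phi -> v <= b) ->
  exists2 chi, first_order chi & forall (M : structure tau) (e : nat -> M),
    #|M| <= s -> sat phi e <-> sat chi e.
Proof.
move=> phib.
pose T := {n : 'I_s.+1 & (code tau n * {ffun 'I_b.+1 -> 'I_n})%type}.
pose str (p : T) : structure tau := decode (tagged p).1.
pose env (p : T) (v : nat) : str p := (tagged p).2 (inord v).
have /choice[c cP] : forall pq : T * T, exists c, [/\ first_order c,
    (forall (O : structure tau) (f g : nat -> O),
       (forall v, v <= b -> f v = g v) -> sat c f <-> sat c g) &
    sat phi (env pq.1) -> ~ sat phi (env pq.2) ->
      sat c (env pq.1) /\ ~ sat c (env pq.2)].
  move=> [p q] /=.
  have [pP|nP] := pselect (sat phi (env p) /\ ~ sat phi (env q)); last first.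
    by exists (FEq tau 0 0); split=> // ? ?; case: nP.
  have : ~ agree b (env p) (env q).
    by move=> /(agree_sat phib) pq; case: pP; rewrite pq.
  move=> /existsNP[d] /not_implyP[dF /not_implyP[dL dN]].
  have [dp|dp] := pselect (sat d (env p)).
    by exists d; split=> // _ _; split=> // dq; apply: dN; tauto.
  exists (FNot d); split=> //=; first by move=> O f g fg; rewrite (dL _ _ _ fg).
  by move=> _ _; split=> // dq; apply: dN; tauto.
have cF pq : first_order (c pq) by have [] := cP pq.
(* Conjuncts for pairs [q] satisfying [phi] are made trivially true, so [d1 p] tests against the
   falsifying ones only. *)
pose d pq := if `[< sat phi (env pq.2) >] then FEq tau 0 0 else c pq.
have dF pq : first_order (d pq) by rewrite /d; case: ifP.
have /choice[d1 d1P] : forall p, exists d1, first_order d1 /\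
    forall (M : structure tau) (e : nat -> M), sat d1 e <-> forall q, sat (d (p, q)) e.
  by move=> p; have [//|x ? ?] := @first_order_conj tau T (fun q => d (p, q)); exists x.
pose d2 p := if `[< sat phi (env p) >] then d1 p else FNot (FEq tau 0 0).
have [p|chi chiF chiE] := @first_order_disj tau T d2.
  by rewrite /d2; case: ifP => // _; have [] := d1P p.
exists chi => // M e Ms; rewrite chiE.
have [m [f [fbij fR]]] := isomorphic_decode M.
have [g fK gK] := fbij.
have Ms' : #|M| < s.+1 by [].
pose r : T := @Tagged 'I_s.+1 (Ordinal Ms') (fun n : 'I_s.+1 =>
  (code tau n * {ffun 'I_b.+1 -> 'I_n})%type) (m, [ffun v : 'I_b.+1 => g (e v)]).
have renv v : v <= b -> (f \o env r) v = e v.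
  by move=> vb; rewrite /= /env /= ffunE gK inordK.
have phie : sat phi e <-> sat phi (env r).
  rewrite (@sat_iso _ _ _ f fbij fR phi (env r)).
  by apply: sat_local => v /phib /renv ->.
have ce p : sat (c p) e <-> sat (c p) (env r).
  rewrite (@sat_iso _ _ _ f fbij fR (c p) (env r)).
  by have [_ cL _] := cP p; apply: cL => v /renv ->.
rewrite phie; split=> [phir|[p]].
  exists r; rewrite /d2 (asboolT phir); apply/(d1P r).2 => q.
  rewrite /d; case: asboolP => //= nq; apply/ce.
  by have [_ _ /(_ phir nq)[]] := cP (r, q).
rewrite /d2; case: asboolP => //= phip /(d1P p).2/(_ r).
rewrite /d; case: asboolP => //= phir /ce.
by have [_ _ /(_ phip phir)[]] := cP (p, r).
Qed.

(** * Generic relations *)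

(** Counting form of independence: a random [E] agrees with [A] on each [S z] with probability at
    least [1 / 2 ^ s], independently for disjoint sets, so it disagrees on all of them with
    probability at most [(1 - 1 / 2 ^ s) ^ size zs]. *)
Lemma card_avoid (T : finType) (Z : eqType) (S : Z -> {set T}) (A : {set T})
    (s : nat) (zs : seq Z) :
  uniq zs -> (forall z, z \in zs -> #|S z| <= s) ->
  (forall z z', z \in zs -> z' \in zs -> z != z' -> [disjoint S z & S z']) ->
  #|[set E : {set T} | all (fun z => E :&: S z != A :&: S z) zs]|
    * (2 ^ s) ^ size zs <= (2 ^ s).-1 ^ size zs * 2 ^ #|T|.
Proof.
elim: zs => [|z zs IH] /=.
  move=> _ _ _; rewrite !expn0 muln1 mul1n.
  apply: leq_trans (max_card _) _; rewrite -cardsT -powersetT card_powerset cardsT //.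
move=> /andP[zzs uzs] Ss Sd.
have {}IH := IH uzs (fun y yzs => Ss y (mem_behead (s := z :: zs) yzs))
  (fun y y' yzs y'zs => Sd y y' (mem_behead (s := z :: zs) yzs) (mem_behead (s := z :: zs) y'zs)).
set N := [set E : {set T} | all _ zs] in IH.
set N' := [set E : {set T} | _].
pose Q := [set E in N | E :&: S z == A :&: S z].
(* Overwriting [E] on [S z] by [A] lands in [Q], since the other sets are disjoint from [S z]; what
   is lost is [E :&: S z], one of at most [2 ^ s] sets. *)
have cN : #|N| <= #|Q| * 2 ^ s.
  pose g (E : {set T}) := ((E :\: S z) :|: (A :&: S z), E :&: S z).
  have ginj : injective g.
    move=> E E' [/setP gE /setP gE']; apply/setP => x.
    by move: (gE x) (gE' x); rewrite !inE; case: (x \in S z); rewrite /= ?andbT ?andbF ?orbF.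
  rewrite -(card_imset _ ginj).
  apply: leq_trans (_ : #|setX Q (powerset (S z))| <= _); last first.
    rewrite cardsX card_powerset leq_mul2l leq_exp2l ?Ss ?mem_head ?orbT //.
  apply: subset_leq_card; apply/subsetP => _ /imsetP[E EN ->].
  rewrite !inE subsetIr andbT; apply/andP; split; last first.
    by apply/eqP/setP => x; rewrite !inE; case: (x \in S z); rewrite /= ?andbT ?andbF ?orbF.
  move: EN; rewrite inE => /allP EN; apply/allP => y yzs.
  have zy : z != y by apply: contraNneq zzs => ->.
  have dzy := Sd z y (mem_head _ _) (mem_behead (s := z :: zs) yzs) zy.
  suff -> : (E :\: S z :|: A :&: S z) :&: S y = E :&: S y by apply: EN.
  apply/setP => x; rewrite !inE; case xy: (x \in S y); rewrite ?andbF ?andbT //.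
  by rewrite (disjointFl dzy xy) /= andbF orbF.
have cN' : #|N'| + #|Q| = #|N|.
  rewrite -(cardsID [set E : {set T} | E :&: S z == A :&: S z] N) addnC; congr (_ + _).
    by apply: eq_card => E; rewrite !inE.
  by apply: eq_card => E; rewrite !inE.
have p : 0 < 2 ^ s by rewrite expn_gt0.
have H : #|N'| * 2 ^ s <= #|N| * (2 ^ s).-1.
  move: cN cN' p; move: #|N'| #|Q| #|N| (2 ^ s) => a q n m; nia.
rewrite !expnS mulnA.
apply: leq_trans (leq_mul H (leqnn _)) _.
by rewrite -mulnA mulnCA -mulnA leq_mul2l IH orbT.
Qed.

Lemma exp_beats_linear (A t : nat) : exists u, A + u * t < 2 ^ u.
Proof.
pose v := (A + t).+1; exists (v * 4).
have hv : v < 2 ^ v by apply: ltn_expl.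
rewrite expnM.
have H : v.+1 ^ 4 <= (2 ^ v) ^ 4 by rewrite leq_exp2r.
apply: leq_trans H.
rewrite !expnS expn0; rewrite /v; nia.
Qed.

Lemma exp_beats_poly (a t : nat) : exists i, a * i.+1 ^ t < 2 ^ i.
Proof.
have [u hu] := exp_beats_linear (a.+1) t.
exists (2 ^ u).-1; rewrite prednK ?expn_gt0 // -expnM.
have ha : a < 2 ^ a by apply: ltn_expl.
apply: leq_trans (_ : 2 ^ a * 2 ^ (u * t) <= _).
  by rewrite ltn_pmul2r ?expn_gt0.
rewrite -expnD leq_exp2l //; lia.
Qed.

Lemma exp_ratio_beats_poly (a t M : nat) :
  exists j, a * (t + j) ^ t * M ^ j < M.+1 ^ j.
Proof.
case: M => [|m].
  by exists 1; rewrite expn1 muln0 expn1.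
set M := m.+1.
have [i hi] := exp_beats_poly (a * (t + M) ^ t) t.
exists (M * i).
(* The first two terms of the binomial expansion both equal [M ^ M]; hence the exponent [M * i]
   gains a factor [2 ^ i]. *)
have H2 : 2 * M ^ M <= M.+1 ^ M.
  rewrite -[M.+1]addn1 expnDn.
  rewrite big_ord_recl big_ord_recl /= bin0 subn0 !exp1n !muln1 mul1n /bump /= bin1.
  by rewrite addnA subn1 -expnS addnn -mul2n leq_addr.
have H3 : 2 ^ i * M ^ (M * i) <= M.+1 ^ (M * i).
  by rewrite !expnM -expnMn; case: i {hi} => [//|i]; rewrite leq_exp2r.
apply: leq_trans H3.
rewrite ltn_pmul2r ?expn_gt0 //.
apply: leq_ltn_trans hi.
rewrite -mulnA leq_mul2l; apply/orP; right.
rewrite -expnMn; case: t => [//|t]; rewrite leq_exp2r //.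
nia.
Qed.

(* A uniformly random relation works with positive probability as soon as [n] is
   large: the copies [(x, z)] of [x] fail independently for distinct [z]. *)
Lemma generic_relation (X : finType) (t : nat) :
  exists n (e : rel (X * 'I_n)), forall (D : {set X * 'I_n}) (p q : pred (X * 'I_n)) x,
    #|D| <= t ->
    exists z, (x, z) \notin D /\
      forall d, d \in D -> e (x, z) d = p d /\ e d (x, z) = q d.
Proof.
have [X0|/card_gt0P[x0 _]] := posnP #|X|.
  by exists 0, (fun _ _ => true) => D p q x; have := fintype0 x X0.
have [j hj] := exp_ratio_beats_poly (4 ^ t * #|X| ^ t * #|X|) t (2 ^ (t + t)).-1.
rewrite prednK ?expn_gt0 // in hj.
pose n := (t + j).
case n0: n => [|n'].
  have t0 : t = 0 by lia.
  have j0 : j = 0 by lia.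
  have X1 : 0 < #|X| by apply/card_gt0P; exists x0.
  by move: hj; rewrite t0 j0 !expn0 !muln1 mul1n; lia.
pose W : finType := (X * 'I_n)%type; pose T : finType := (W * W)%type.
pose Y : finType := (W * (bool * bool))%type.
(* A request consists of a point [x] and of [t] points, each with the two edge values wanted between
   it and the copy of [x]. *)
pose Req : finType := (t.-tuple Y * X)%type.
pose D (r : Req) : {set W} := [set (y : Y).1 | y in tval r.1].
pose A (r : Req) : {set T} := [set ab | has (fun y : Y =>
  ((ab.2 == y.1) && (ab.1 \notin D r) && y.2.1) ||
  ((ab.1 == y.1) && (ab.2 \notin D r) && y.2.2)) (tval r.1)].
pose S (r : Req) (z : 'I_n) : {set T} :=
  [set (((r.2, z) : W), d) | d in D r] :|: [set (d, ((r.2, z) : W)) | d in D r].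
pose zs (r : Req) := [seq z <- enum 'I_n | ((r.2, z) : W) \notin D r].
pose Bad (r : Req) : {set {set T}} :=
  [set E | all (fun z => E :&: S r z != A r :&: S r z) (zs r)].
have cD r : #|D r| <= t.
  apply: leq_trans (leq_imset_card _ _) _.
  by rewrite -[X in _ <= X](size_tuple r.1) card_size.
have szs r : j <= size (zs r).
  rewrite -(leq_add2l t) -/n -[X in X <= _]size_enum_ord.
  rewrite -(count_predC (fun z => ((r.2, z) : W) \in D r)) size_filter leq_add2r.
  apply: leq_trans (cD r).
  rewrite -size_filter -(size_map (fun z => ((r.2, z) : W))) cardE.
  apply: uniq_leq_size.
    rewrite map_inj_uniq; last by move=> ? ? [].
    exact/filter_uniq/enum_uniq.
  by move=> _ /mapP[z + ->]; rewrite mem_filter mem_enum => /andP[].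
have cBad r : #|Bad r| * (2 ^ (t + t)) ^ j <= (2 ^ (t + t)).-1 ^ j * 2 ^ #|T|.
  have H := @card_avoid T 'I_n (S r) (A r) (t + t) (take j (zs r)) _ _ _.
  rewrite size_takel // in H.
  apply: leq_trans (H _ _ _).
  - rewrite leq_mul2r; apply/orP; right; apply: subset_leq_card.
    apply/subsetP => E; rewrite !inE => /allP EA; apply/allP => z /mem_take; apply: EA.
  - by rewrite take_uniq // filter_uniq // enum_uniq.
  - move=> z _; apply: leq_trans (leq_card_setU _ _) _.
    by apply: leq_add; apply: leq_trans (leq_imset_card _ _) (cD r).
  - move=> z z' /mem_take + /mem_take + zz'; rewrite !mem_filter => /andP[zD _] /andP[zD' _].
    apply/pred0P => -[a b] /=; apply/negP; rewrite !inE => /andP[].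
    case/orP=> /imsetP[d dD [-> ->]] /orP[] /imsetP[d' dD' [e1 e2]].
    + by rewrite e1 eqxx in zz'.
    + by rewrite -e1 (negPf zD) in dD'.
    + by rewrite -e1 dD in zD'.
    + by rewrite e2 eqxx in zz'.
(* Union bound over all requests; [j] was chosen large enough for their number. *)
have cU : #|\bigcup_r Bad r| < 2 ^ #|T|.
  have cR : #|{: Req}| = 4 ^ t * #|X| ^ t * #|X| * n ^ t.
    by rewrite !card_prod card_tuple !card_prod !card_bool card_ord !expnMn; lia.
  have cS : #|\bigcup_r Bad r| <= \sum_r #|Bad r|.
    elim/big_ind2: _ => [|a b c d ab cd|//]; first by rewrite cards0.
    by apply: leq_trans (leq_card_setU _ _) _; apply: leq_add.
  have : \sum_r #|Bad r| * (2 ^ (t + t)) ^ j <= \sum_(r : Req) (2 ^ (t + t)).-1 ^ j * 2 ^ #|T|.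
    by apply: leq_sum => r _; apply: cBad.
  rewrite -big_distrl /= sum_nat_const cR.
  move: cS hj; rewrite -/n.
  have : 0 < 2 ^ #|T| by rewrite expn_gt0.
  move: (\sum_r _) (#|\bigcup_r _|) (2 ^ #|T|) ((2 ^ (t + t)) ^ j) ((2 ^ (t + t)).-1 ^ j).
  move=> a b c d f c0 ba hd H.
  have H1 : a * d < d * c.
    apply: leq_ltn_trans H _.
    by rewrite mulnA ltn_pmul2r.
  by rewrite mulnC ltn_mul2l in H1; case/andP: H1 => _; apply: leq_ltn_trans.
have [E EB] : exists E, E \notin \bigcup_r Bad r.
  apply/existsP; apply: contraLR cU; rewrite negb_exists -leqNgt => /forallP EB.
  rewrite -cardsT -card_powerset powersetT; apply: subset_leq_card.
  by apply/subsetP => E _; have := EB E; rewrite negbK.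
exists n, (fun a b => (a, b) \in E) => D0 p q x cD0.
pose y0 : Y := ((x, cast_ord (esym n0) ord0), (false, false)).
pose mk (d : W) : Y := (d, (p d, q d)).
pose s0 := map mk (enum D0).
have ss0 : size s0 <= t by rewrite size_map -cardE.
have [s [ssz [sD sE]]] : exists s : seq Y, size s = t /\
    ((forall d, d \in D0 -> mk d \in s) /\ (forall y, y \in s -> y = mk y.1)).
  (* Requests have exactly [t] entries, so a smaller set is padded by repeating an entry; for the
     empty set a copy of [x] is used, which exists because [n] is positive. *)
  exists (s0 ++ nseq (t - size s0) (head (mk y0.1) s0)).
  rewrite size_cat size_nseq subnKC //; split=> //; split.
    by move=> d dD; rewrite mem_cat map_f // mem_enum.
  move=> y; rewrite mem_cat mem_nseq => /orP[/mapP[d _ ->] //|/andP[_ /eqP ->]].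
  case e0 : s0 => [|a s1] //=; have : a \in s0 by rewrite e0 mem_head.
  by case/mapP=> d _ ->.
pose r : Req := (Tuple (introT eqP ssz), x).
have D0r d : d \in D0 -> d \in D r.
  by move=> /sD ds; apply/imsetP; exists (mk d).
have : E \notin Bad r by apply: contra EB => EBr; apply/bigcupP; exists r.
rewrite inE => /allPn[z]; rewrite mem_filter => /andP[zD _] /negPn/eqP/setP ES.
exists z; split; first by apply: contra zD => /D0r.
have inA a b : (a, b) \in A r = has (fun y : Y =>
    ((b == y.1) && (a \notin D r) && y.2.1) ||
    ((a == y.1) && (b \notin D r) && y.2.2)) s by rewrite inE.
have sDr y : y \in s -> y.1 \in D r.
  by move=> ys; apply/imsetP; exists y.
move=> d dD; split.
  have := ES ((x, z), d); rewrite in_setI [in RHS]in_setI.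
  have -> : (((x, z) : W), d) \in S r z.
    by rewrite inE; apply/orP; left; apply/imsetP; exists d => //; apply: D0r.
  rewrite !andbT => ->; rewrite inA; apply/hasP/idP => [[y ys]|pd].
    case/orP=> /andP[/andP[/eqP e1 _] e2].
      by move: e2; rewrite (sE _ ys) /= -e1.
    by case/negP: zD; move: (sDr _ ys); rewrite -e1.
  by exists (mk d); [exact: sD | rewrite /= eqxx zD pd].
have := ES (d, (x, z)); rewrite in_setI [in RHS]in_setI.
have -> : (d, ((x, z) : W)) \in S r z.
  by rewrite inE; apply/orP; right; apply/imsetP; exists d => //; apply: D0r.
rewrite !andbT => ->; rewrite inA; apply/hasP/idP => [[y ys]|pd].
  case/orP=> /andP[/andP[/eqP e1 _] e2].
    by case/negP: zD; move: (sDr _ ys); rewrite -e1.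
  by move: e2; rewrite (sE _ ys) /= -e1.
by exists (mk d); [exact: sD | rewrite /= eqxx zD pd orbT].
Qed.

(** * The tower *)

Section Tower.
Variables (tau : vocabulary) (N : structure tau).

(** In the tower, [base] is the ancestor in level 0; it lets the relations of [N] be read off at
    every stage without tracking how level 0 is embedded. *)
Record stage := Stage {
  pts :> finType;
  lev : pts -> nat;
  adj : rel pts;
  base : pts -> N
}.

Definition expand (S : stage) : structure (add_binary tau) :=
  @Structure (add_binary tau) S (fun R =>
    match R return (arity (R : add_binary tau)).-tuple S -> bool with
    | None => fun t => adj (tnth t ord0) (tnth t ord_max)
    | Some R => fun t =>
        all (fun x => lev x == 0) t && interp N R (map_tuple (@base S) t)
    end).

(** * Adding one level *)

Section Step.
Variables (S : stage) (i K k : nat) (F : {set {set S}}).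

(** The components are a parent, a shade, and a mark for each set of points. Marks are pairs, so
    that [K.+1] points above each of [k.+1] vertices can exhaust them, while those above fewer
    vertices cannot. *)
Definition label : finType :=
  ({u : S | lev u == i} * 'I_K.+1 * {ffun {set S} -> 'I_k.+1 * 'I_K.+1})%type.

Definition width : nat := sval (cid (generic_relation label (k.+1 * K.+1))).

Definition newpt : finType := (label * 'I_width)%type.

Definition raw : rel newpt :=
  sval (cid (svalP (cid (generic_relation label (k.+1 * K.+1))))).

Lemma rawP (D : {set newpt}) (p q : pred newpt) (x : label) :
  #|D| <= k.+1 * K.+1 ->
  exists z : 'I_width, ((x, z) : newpt) \notin D /\
    forall d, d \in D -> raw (x, z) d = p d /\ raw d (x, z) = q d.
Proof. exact: (svalP (cid (svalP (cid (generic_relation label (k.+1 * K.+1)))))). Qed.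

Definition color (a : newpt) : S := val a.1.1.1.
Definition shade (a : newpt) : 'I_K.+1 := a.1.1.2.
Definition mark (a : newpt) (Y : {set S}) : 'I_k.+1 * 'I_K.+1 := a.1.2 Y.

(* The condition under which the raw edge from [a] to [b] is kept: it depends on
   whether the raw edge is mutual or one-way. *)
Definition gate (a b : newpt) : bool :=
  if raw b a then shade a != shade b
  else [forall Y in F, (color a \in Y) && (color b \in Y) ==> (mark a Y != mark b Y)].

Definition new_adj (a b : newpt) : bool := raw a b && gate a b.

Definition step : stage := @Stage (S + newpt)%type
  (fun x => match x with inl u => lev u | inr _ => i.+1 end)
  (fun x y => match x, y with
   | inl u, inl v => adj u v
   | inl u, inr b => adj u (color b)
   | inr a, inl v => adj (color a) v
   | inr a, inr b => new_adj a b
   end)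
  (fun x => match x with inl u => base u | inr a => base (color a) end).

Lemma lev_color a : lev (color a) = i.
Proof. exact/eqP/(valP a.1.1.1). Qed.

(** A loop would be a mutual edge between equal shades; this keeps the new points out of the
    substructure defined by loops. *)
Lemma new_adj_irr a : new_adj a a = false.
Proof. by rewrite /new_adj /gate; case: (raw a a); rewrite //= eqxx. Qed.

Lemma exists_out (T I : finType) (f : I -> T) (A : {set I}) :
  #|A| < #|T| -> exists x, forall j, j \in A -> f j != x.
Proof.
move=> AT; have [x xA] : exists x, x \notin f @: A.
  apply/existsP; apply: contraLR AT; rewrite negb_exists -leqNgt => /forallP H.
  apply: leq_trans (leq_imset_card f A); rewrite -cardsT; apply: subset_leq_card.
  by apply/subsetP => x _; have := H x; rewrite negbK.
by exists x => j jA; apply: contraNneq xA => <-; apply: imset_f.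
Qed.

(** At most [K] points leave a shade and, for every set, a mark free. A point carrying these passes
    every gate, and genericity supplies the edges. *)
Lemma step_ext (D : {set newpt}) (u : S) (p q : pred newpt) :
  #|D| <= K -> lev u = i ->
  exists a, [/\ color a = u, a \notin D &
    forall d, d \in D -> new_adj a d = p d /\ new_adj d a = q d].
Proof.
move=> DK /eqP ui.
have [v0 v0P] : exists v, forall d, d \in D -> shade d != v.
  by apply: exists_out; rewrite card_ord.
have KH : K < #|{: 'I_k.+1 * 'I_K.+1}|.
  by rewrite card_prod !card_ord leq_pmull.
have /choice[h hP] : forall Y, exists c, forall d, d \in D -> mark d Y != c.
  by move=> Y; apply: exists_out; apply: leq_ltn_trans DK KH.
have [|z [zD zP]] := @rawP D p q (Sub u ui, v0, [ffun Y => h Y]).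
  by apply: leq_trans DK _; rewrite ltnW // leq_pmull.
set a : newpt := (_, z) in zD zP.
exists a; split=> // d dD.
have [ad da] := zP d dD.
have m Y : mark d Y != mark a Y by rewrite /mark /= ffunE; apply: hP.
have sh : shade d != shade a by apply: v0P.
rewrite /new_adj /gate ad da; split.
  case: (p d) => //=; case: (q d); first by rewrite eq_sym.
  by apply/forall_inP => Y _; apply/implyP => _; rewrite eq_sym.
case: (q d) => //=; case: (p d); first by [].
by apply/forall_inP => Y _; apply/implyP => _.
Qed.

(** Give [a] all shades in turn: any [w] shares its shade with one of these points, which excludes a
    mutual edge. *)
Lemma step_block (a : newpt) :
  exists C : 'I_K.+1 -> newpt, (exists j, C j = a) /\
    forall w, exists j, ~ (new_adj w (C j) /\ new_adj (C j) w).
Proof.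
exists (fun j => ((a.1.1.1, j, a.1.2), a.2)); split.
  by exists a.1.1.2; case: a => [[[? ?] ?] ?].
move=> w; exists (shade w); set b : newpt := (_, _).
move=> [/andP[_ sh] /andP[bw _]]; move: sh.
by rewrite /gate bw /shade /= eqxx.
Qed.

(** The points [f x] exhaust the marks: every [w] above [Y] agrees with one of them in its mark for
    [Y], which excludes a one-way edge. *)
Lemma step_code_mem (Y : {set S}) (y : 'I_k.+1 -> S) :
  Y \in F -> (forall j, lev (y j) = i) -> (forall j, y j \in Y) ->
  exists f : 'I_k.+1 * 'I_K.+1 -> newpt, (forall x, color (f x) = y x.1) /\
    forall w, color w \in Y -> exists x, ~ (new_adj w (f x) /\ ~ new_adj (f x) w).
Proof.
move=> YF yi yY.
have yi' j : lev (y j) == i by apply/eqP.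
pose l0 : label := (Sub (y ord0) (yi' ord0), ord0, [ffun=> (ord0, ord0)]).
have [|z _] := @rawP set0 pred0 pred0 l0; first by rewrite cards0.
exists (fun x => ((Sub (y x.1) (yi' x.1), ord0, [ffun=> x]), z)).
split=> // w wY; exists (mark w Y); set f : newpt := (_, z).
move=> [/andP[wf +] /negP nfw]; rewrite /gate.
(* For mutual raw edges the gate treats both directions alike, so an edge that survives is not
   one-way. *)
case fw: (raw f w).
  by move=> sh; move: nfw; rewrite /new_adj fw /gate wf eq_sym sh.
move=> /forall_inP/(_ Y YF); rewrite wY.
have -> : color f \in Y by apply: yY.
by rewrite /= /mark /= ffunE eqxx.
Qed.

(** Each [Y] in [F] misses some [y j], so the points [f x] above [Y] leave a mark for [Y] free. A
    generic [w] with free marks keeps a one-way edge to every [f x]; this is why genericity is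
    demanded for [k.+1 * K.+1] points. *)
Lemma step_code_notin (y : 'I_k.+1 -> S) (u : S)
    (f : 'I_k.+1 * 'I_K.+1 -> newpt) :
  (forall Y, Y \in F -> exists j, y j \notin Y) -> lev u = i ->
  (forall x, color (f x) = y x.1) ->
  exists w, color w = u /\ forall x, new_adj w (f x) /\ ~ new_adj (f x) w.
Proof.
move=> yF /eqP ui fy.
have /choice[h hP] : forall Y, exists c, Y \in F ->
    forall x, y x.1 \in Y -> mark (f x) Y != c.
  move=> Y; have [YF|YF] := boolP (Y \in F); last by exists (ord0, ord0).
  have [j jY] := yF Y YF.
  have [|c cP] := @exists_out _ _ (fun x => mark (f x) Y) [set x | y x.1 \in Y].
    rewrite -[X in _ < X]cardsT; apply: proper_card; apply/properP; split.
      by apply/subsetP => x; rewrite inE.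
    by exists (j, ord0); rewrite !inE.
  by exists c => _ x xY; apply: cP; rewrite inE.
have [|z [_ zP]] := @rawP (f @: setT) predT pred0 (Sub u ui, ord0, [ffun Y => h Y]).
  by apply: leq_trans (leq_imset_card _ _) _; rewrite cardsT card_prod !card_ord.
set w : newpt := (_, z) in zP; exists w; split=> // x.
have [wf fw] := zP (f x) (imset_f f (in_setT x)).
rewrite /new_adj fw wf /gate fw /=; split=> //.
apply/forall_inP => Y YF; apply/implyP => /andP[_ fY].
by rewrite eq_sym /mark /= ffunE; apply: hP => //; rewrite -fy.
Qed.

End Step.

(** * Iterating the step, and ancestors in the tower *)

Variables (phi : nat -> formula (add_binary tau)) (bnd : nat -> nat).

(* Every pattern over at most [cap n] points of level [n] extends. *)
Definition cap (n : nat) : nat := n + \sum_(j < n.+1) (bnd j).+2.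

Lemma cap_ltn n m : n < m -> cap n < cap m.
Proof.
move=> nm; rewrite /cap -addSn; apply: leq_add => //.
rewrite -(subnKC (leqW nm : n.+1 <= m.+1)).
by rewrite big_split_ord /= leq_addr.
Qed.

Lemma bnd_cap n m : n <= m -> (bnd n).+1 < cap m.
Proof.
move=> nm; rewrite /cap; apply: leq_trans (leq_addl _ _).
have nm' : n < m.+1 by [].
by rewrite (bigD1 (Ordinal nm')) //= leq_addr.
Qed.

(* For points of level at least [l], this means having the same ancestor of level
   [l]; see [simP]. *)
Definition sim (S : stage) (l : nat) (x y : S) : Prop :=
  forall w, lev w = l -> adj x w = adj y w.

(** A linear order given by one-way edges, so that the set of vertices determines their indices. *)
Definition tournament (S : stage) (b : nat) (y : 'I_b.+1 -> S) : Prop :=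
  forall v w : 'I_b.+1, v < w -> adj (y v) (y w) /\ ~ adj (y w) (y v).

(* The formula [phi n] is evaluated at ancestors of the vertices of [y], the [v]-th
   one being taken in the level [nth 0 r v]. *)
Definition holds_at (S : stage) (n : nat) (r : seq nat)
    (y : 'I_(bnd n).+1 -> S) : Prop :=
  exists2 e : nat -> S,
    forall v : 'I_(bnd n).+1,
      lev (e v) = nth 0 r v /\ sim (nth 0 r v) (e v) (y v) &
    sat (M := expand S) (phi n) e.

Definition family (S : stage) (i n : nat) (r : seq nat) : {set {set S}} :=
  [set Y | `[< exists y : 'I_(bnd n).+1 -> S,
    [/\ Y = [set y v | v in [set: 'I_(bnd n).+1]], (forall v, lev (y v) = i),
        tournament y & ~ holds_at r y] >]].

(* The third component of an unpickled triple is padding: it makes every pair come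
   up at arbitrarily high levels. *)
Definition request (i : nat) : nat * seq nat :=
  if @unpickle (nat * seq nat * nat)%type i is Some (x, _) then x else (0, [::]).

(** Request [i'] is evaluated in [tower i'], and its result is stored in the edges of level
    [i'.+1]. *)
Fixpoint tower (i : nat) : stage :=
  if i is i'.+1 then
    @step (tower i') i' (cap i) (bnd (request i').1)
      (@family (tower i') i' (request i').1 (request i').2)
  else @Stage N (fun=> 0) (fun x y => x == y) id.

(** Evidence for [l <= i] in [Type]: by recursion on it, [up] and [down] pass between [tower l] and
    [tower i] without casts. *)
Inductive chain (l : nat) : nat -> Type :=
| Chain0 : chain l l
| ChainS i : chain l i -> chain l i.+1.

Lemma chain_le l i : l <= i -> chain l i.
Proof.
elim: i => [|i IH] li.
  by have -> : l = 0; [apply/eqP; rewrite -leqn0 | exact: Chain0].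
case: (eqVneq l i.+1) => [->|ne]; first exact: Chain0.
by apply/ChainS/IH; rewrite -ltnS ltn_neqAle ne.
Qed.

Lemma le_chain l i : chain l i -> l <= i.
Proof. by elim=> // j _ /leqW. Qed.

Fixpoint chain_trans k l i (p : chain k l) (q : chain l i) : chain k i :=
  match q with
  | Chain0 => p
  | ChainS _ q => ChainS (chain_trans p q)
  end.

Fixpoint up l i (p : chain l i) : tower l -> tower i :=
  match p with
  | Chain0 => id
  | ChainS _ p => fun x => inl (up p x)
  end.

Definition parent i (x : tower i.+1) : tower i :=
  match x with inl u => u | inr a => color a end.

(** Points of level at most [l] are kept; all others go to their ancestor of level [l]. *)
Fixpoint down l i (p : chain l i) : tower i -> tower l :=
  match p with
  | Chain0 => id
  | ChainS _ p => fun x => down p (parent x)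
  end.

Lemma down_trans k l i (p : chain k l) (q : chain l i) x :
  down (chain_trans p q) x = down p (down q x).
Proof. by elim: q x => //= j q IH x; rewrite IH. Qed.

Lemma up_trans k l i (p : chain k l) (q : chain l i) x :
  up (chain_trans p q) x = up q (up p x).
Proof. by elim: q => //= j q ->. Qed.

Lemma upK l i (p : chain l i) : cancel (up p) (down p).
Proof. by elim: p => //= j p IH x; rewrite IH. Qed.

Lemma lev_le i (x : tower i) : lev x <= i.
Proof. by elim: i x => [//|i IH] [x|a] //=; apply: leqW. Qed.

Lemma lev_up l i (p : chain l i) x : lev (up p x) = lev x.
Proof. by elim: p => //= j p IH. Qed.

Lemma base_down l i (p : chain l i) x : base (down p x) = base x.
Proof. by elim: p x => //= j p IH [x|a]; rewrite IH. Qed.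

Lemma downK l i (p : chain l i) x : lev x <= l -> up p (down p x) = x.
Proof.
elim: p x => //= j p IH [x|a] /= xl; first by rewrite IH.
by have := leq_trans xl (le_chain p); rewrite ltnn.
Qed.

Lemma lev_down l i (p : chain l i) x : l <= lev x -> lev (down p x) = l.
Proof.
elim: p x => [|j p IH] x /=; first by move=> lx; apply/eqP; rewrite eqn_leq lev_le.
by case: x => [x|a] /= lx; apply: IH => //; rewrite lev_color le_chain.
Qed.

Lemma lev_down_low l i (p : chain l i) x : lev x <= l -> lev (down p x) = lev x.
Proof. by move=> xl; rewrite -[in RHS](downK p xl) lev_up. Qed.

Lemma adj_upr l i (p : chain l i) x y : adj x (up p y) = adj (down p x) y.
Proof. by elim: p x => //= j p IH [x|a] /=; rewrite IH. Qed.

Lemma adj_upl l i (p : chain l i) x y : adj (up p y) x = adj y (down p x).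
Proof. by elim: p x => //= j p IH [x|a] /=; rewrite IH. Qed.

Lemma adj_refl i (x : tower i) : adj x x = (lev x == 0).
Proof.
elim: i x => [x|i IH [x|a]] /=; [by rewrite eqxx | exact: IH | exact: new_adj_irr].
Qed.

(** The point is raised one level at a time: its ancestor of level [j] already has the wanted edges
    with the points of [D] in levels [l.+1] to [j], and edges across levels are inherited from the
    ancestor. *)
Lemma tower_ext l i (p : chain l i) (D : {set tower i}) (u : tower l)
    (P Q : pred (tower i)) :
  (forall n, l < n -> #|[set d in D | lev d == n]| <= cap n) -> lev u = l ->
  exists w, [/\ lev w = i, down p w = u, (l < i -> w \notin D) &
    forall d, d \in D -> l < lev d -> adj w d = P d /\ adj d w = Q d].
Proof.
elim: p D P Q => [|j p IH] D P Q cD ul.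
  exists u; split=> //= [|d _]; first by rewrite ltnn.
  by rewrite ltnNge lev_le.
have [|w0 [wj wu _ wP]] := IH [set x | inl x \in D] (fun x => P (inl x)) (fun x => Q (inl x)) _ ul.
  move=> n ln; apply: leq_trans (cD n ln).
  have inj : injective (fun x : tower j => inl x : tower j.+1) by move=> ? ? [].
  rewrite -(card_imset _ inj); apply: subset_leq_card.
  by apply/subsetP => _ /imsetP[x + ->]; rewrite !inE.
have [|a [aw aD aP]] := @step_ext (tower j) j (cap j.+1) (bnd (request j).1)
    (@family (tower j) j (request j).1 (request j).2)
    [set a | inr a \in D] w0 (fun x => P (inr x)) (fun x => Q (inr x)) _ wj.
  apply: leq_trans (cD j.+1 (le_chain p : l < j.+1)).
  have inj : injective (fun a => inr a : tower j.+1) by move=> ? ? [].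
  rewrite -(card_imset _ inj); apply: subset_leq_card.
  by apply/subsetP => _ /imsetP[x + ->]; rewrite !inE /= eqxx andbT.
exists (inr a); split=> //=.
- by rewrite aw.
- by move=> _; move: aD; rewrite inE.
- case=> [x|b] xD lx /=; first by rewrite aw; apply: wP; rewrite ?inE.
  by apply: aP; rewrite inE.
Qed.

(** * Recognising ancestors and levels; back-and-forth between towers *)

Lemma sim_sym (S : stage) l (x y : S) : sim l x y -> sim l y x.
Proof. by move=> s w wl; rewrite s. Qed.

Lemma sim_trans (S : stage) l (x y z : S) : sim l x y -> sim l y z -> sim l x z.
Proof. by move=> s t w wl; rewrite s ?t. Qed.

(** In level 0 adjacency is equality; in a higher level, distinct points are told apart by a generic
    point that receives an edge from one of them only. *)
Lemma sim_top l (u u' : tower l) : lev u = l -> lev u' = l -> sim l u u' -> u = u'.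
Proof.
case: l u u' => [u u' _ _ /(_ u erefl)|l u u' ul u'l s].
  by move=> /= /esym; rewrite eqxx => /eqP.
pose p : chain l l.+1 := ChainS (Chain0 l).
have [| |w [wl _ _ wP]] := @tower_ext l l.+1 p [set u; u'] (down p u) predT (pred1 u).
- move=> n ln; apply: leq_trans (_ : 2 <= _); last exact: leq_ltn_trans (bnd_cap (leqnn n)).
  apply: leq_trans (_ : #|[set u; u']| <= _); last by rewrite cards2; case: (_ != _).
  by apply: subset_leq_card; apply/subsetP => x; rewrite inE => /andP[].
- by apply: lev_down; rewrite ul.
have [||_ uw] := wP u; rewrite ?inE ?eqxx ?ul //.
have [||_ u'w] := wP u'; rewrite ?inE ?eqxx ?orbT ?u'l //.
by move: (s w wl); rewrite uw u'w /= eqxx => /esym/eqP.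
Qed.

Lemma simP l i (p : chain l i) x y : l <= lev x -> l <= lev y ->
  sim l x y <-> down p x = down p y.
Proof.
move=> lx ly; split=> [s|xy w wl].
  apply: sim_top; rewrite ?lev_down // => w wl.
  by rewrite -!adj_upr s ?lev_up.
by rewrite -(downK p (x := w)) ?wl // !adj_upr xy.
Qed.

Lemma sim_up k l i (p : chain l i) x y : k <= l ->
  sim k (up p x) (up p y) <-> sim k x y.
Proof.
move=> kl; split=> s w wk.
  by have := s (up p w); rewrite lev_up wk !adj_upr !upK; apply.
by rewrite -(downK p (x := w)) ?wk // !adj_upr !upK; apply: s; rewrite lev_down_low ?wk.
Qed.

(* The points of level [l + 1] are recognised by the shades: a full set of shades
   has no common mutual neighbour, while smaller sets always have one. *)
Lemma levelP l i (x : tower i) : l < i ->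
  lev x = l.+1 <-> l < lev x /\
    exists C : 'I_(cap l.+1).+1 -> tower i,
      [/\ forall j, l < lev (C j), exists j, C j = x &
          forall w, l < lev w -> exists j, ~ (adj w (C j) /\ adj (C j) w)].
Proof.
move=> li; split=> [xl|[lx [C [lC [j Cj] Cw]]]].
  split; first by rewrite xl.
  have p := chain_le li.
  have xE := downK p (x := x); rewrite xl in xE; have {}xE := xE (leqnn _).
  have := lev_down p (x := x); rewrite xl => /(_ (leqnn _)).
  case: (down p x) xE => [u|a] xE /= ul; first by have := lev_le u; rewrite ul ltnn.
  have [C [[j Cj] Cw]] := step_block (family (tower l) l (request l).1 (request l).2) a.
  exists (fun j => up p (inr (C j))); split.
  - by move=> k; rewrite lev_up.
  - by exists j; rewrite Cj.
  - move=> w lw; have := lev_down p lw.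
    case E: (down p w) => [u|b] /= ul'; first by have := lev_le u; rewrite ul' ltnn.
    have [k Ck] := Cw b; exists k; rewrite adj_upr adj_upl E; exact: Ck.
apply/eqP; rewrite eqn_leq lx andbT leqNgt; apply/negP => lx'.
have p := chain_le (ltnW li).
(* If [x] lies above level [l.+1], then [C] has at most [cap l.+1] points in that level and no more
   than the larger [cap n] in a higher level [n], so a common mutual neighbour exists. *)
have [| |w [wi _ _ wP]] := @tower_ext l i p (C @: setT) (down p x) predT predT.
- move=> n; rewrite leq_eqVlt => /predU1P[<-|ln].
    rewrite -ltnS -[X in _ < X]card_ord -cardsT.
    apply: leq_trans (leq_imset_card C _).
    apply: proper_card; apply/properP; split; first by apply/subsetP => d; rewrite inE => /andP[].
    exists x; first by rewrite -Cj imset_f.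
    by rewrite inE (gtn_eqF lx') andbF.
  apply: leq_trans (cap_ltn ln); rewrite -[X in _ <= X]card_ord -cardsT.
  apply: leq_trans (leq_imset_card C _); apply: subset_leq_card.
  by apply/subsetP => d; rewrite inE => /andP[].
- exact/lev_down/ltnW.
have [|k Ck] := Cw w; first by rewrite wi.
by apply: Ck; have [] := wP (C k) (imset_f C (in_setT k)) (lC k) => -> ->.
Qed.

(* The back-and-forth system: the same ancestors of level [m], and above that level
   the same pattern of equalities and edges. *)
Definition linked (b m i i' : nat) (p : chain m i) (p' : chain m i')
    (e : nat -> tower i) (e' : nat -> tower i') : Prop :=
  forall v, v <= b ->
    [/\ down p (e v) = down p' (e' v), (m < lev (e v)) = (m < lev (e' v)) &
      forall w, w <= b -> (e v == e w) = (e' v == e' w) /\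
                          adj (e v) (e w) = adj (e' v) (e' w)].

Lemma lev0_linked m i i' (p : chain m i) (p' : chain m i') x y :
  down p x = down p' y -> (m < lev x) = (m < lev y) -> (lev x == 0) = (lev y == 0).
Proof.
move=> d; have [xm|mx] := leqP (lev x) m => /esym.
  by move=> /negbT; rewrite -leqNgt => ym; rewrite -(lev_down_low p xm) d lev_down_low.
by move=> my; rewrite !gtn_eqF // (leq_ltn_trans (leq0n m)).
Qed.

Lemma linked_sym b m i i' (p : chain m i) (p' : chain m i') e e' :
  linked b p p' e e' -> linked b p' p e' e.
Proof.
move=> ee' v vb; have [d l ea] := ee' v vb; split=> // w wb.
by have [-> ->] := ea w wb.
Qed.

(** A point of level at most [m] is answered by itself, a named point by its namesake, any other by
    a generic point of the top level with the same ancestor. Edges to levels up to [m] follow from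
    the ancestors; edges to higher levels are prescribed. *)
Lemma linked_forth b m i i' (p : chain m i) (p' : chain m i') e e' v x :
  (forall n, m < n -> b < cap n) -> m < i' -> v <= b -> linked b p p' e e' ->
  exists y, linked b p p' [eta e with v |-> x] [eta e' with v |-> y].
Proof.
move=> capb mi' vb ee'.
suff [y [dy ly yP]] : exists y, [/\ down p x = down p' y, (m < lev x) = (m < lev y) &
    forall w, w <= b -> w != v ->
      [/\ (x == e w) = (y == e' w), adj x (e w) = adj y (e' w) &
          adj (e w) x = adj (e' w) y]].
  have xy : adj x x = adj y y.
    by rewrite !adj_refl (lev0_linked dy ly).
  exists y => u ub /=; case: (eqVneq u v) => [uv|uv].
    split=> // w wb; case: (eqVneq w v) => [wv|wv]; first by rewrite !eqxx.
    by have [] := yP w wb wv.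
  have [du lu uP] := ee' u ub; split=> // w wb; case: (eqVneq w v) => [wv|wv].
    by have [xu ux xu'] := yP u ub uv; rewrite eq_sym xu eq_sym.
  exact: uP.
have [xm|mx] := leqP (lev x) m.
  have xE := downK p xm; exists (up p' (down p x)).
  have ym : lev (up p' (down p x)) <= m by rewrite lev_up lev_down_low.
  split; first by rewrite upK.
    by rewrite ltnNge ym.
  move=> w wb _; have [dw lw _] := ee' w wb; split.
  - have [wm|mw] := leqP (lev (e w)) m; last first.
      have -> : (x == e w) = false by apply/eqP => xw; rewrite -xw ltnNge xm in mw.
      by apply/esym/eqP => yw; move: lw; rewrite -yw mw ltnNge ym.
    have wm' : lev (e' w) <= m by rewrite leqNgt -lw -leqNgt.
    rewrite -{1}xE -{1}(downK p wm) -(downK p' wm') dw.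
    by rewrite (can_eq (upK p)) (can_eq (upK p')).
  - by rewrite -{1}xE !adj_upl dw.
  - by rewrite -{1}xE !adj_upr dw.
have [[w /andP[wb wv] xw]|nw] := pselect (exists2 w, (w <= b) && (w != v) & x = e w).
  exists (e' w); have [dw lw wP] := ee' w wb.
  rewrite -lw -dw -xw mx; split=> // u ub _; rewrite xw.
  by have [? ?] := wP u ub; have [_ _ /(_ w wb)[]] := ee' u ub.
pose D := [set e' (val w) | w in [set w : 'I_b.+1 | val w != v]].
(* [P] and [Q] do not depend on the variable naming [d], because linked assignments have the same
   equalities. *)
pose P d := [exists w : 'I_b.+1, (e' w == d) && adj x (e w)].
pose Q d := [exists w : 'I_b.+1, (e' w == d) && adj (e w) x].
have [||y [yi yx yD yP]] := @tower_ext m i' p' D (down p x) P Q.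
- move=> n mn; apply: leq_trans (capb n mn).
  rewrite -[X in _ <= X]card_ord -cardsT.
  apply: leq_trans (_ : #|D| <= _); first by apply: subset_leq_card; apply/fintype.subsetP => d; rewrite inE => /andP[].
  by apply: leq_trans (leq_imset_card _ _) _; apply: subset_leq_card; apply/fintype.subsetP => d; rewrite inE.
- exact/lev_down/ltnW.
have my : m < lev y by rewrite yi.
exists y; split=> // w wb wv.
have [dw lw wP] := ee' w wb.
have wD : e' w \in D.
  by apply/imsetP; exists (inord w); rewrite ?inE /= inordK.
have Pw : P (e' w) = adj x (e w).
  apply/existsP/idP => [[u /andP[/eqP uw]]|xw].
    have -> // : e u = e w.
    by apply/eqP; have [_ _ /(_ w wb)[-> _]] := ee' u (ltn_ord u); rewrite uw.
  by exists (inord w); rewrite inordK // eqxx.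
have Qw : Q (e' w) = adj (e w) x.
  apply/existsP/idP => [[u /andP[/eqP uw]]|xw].
    have -> // : e u = e w.
    by apply/eqP; have [_ _ /(_ w wb)[-> _]] := ee' u (ltn_ord u); rewrite uw.
  by exists (inord w); rewrite inordK // eqxx.
split.
- rewrite [RHS]negbTE; last by apply: contra (yD mi') => /eqP ->.
  by apply/eqP => xw; apply: nw; exists w; rewrite ?wb.
- have [wm|mw] := leqP (lev (e' w)) m; last by have [-> _] := yP _ wD mw.
  rewrite -(downK p' wm) adj_upr yx -dw -adj_upr downK //.
  by rewrite leqNgt lw -leqNgt.
- have [wm|mw] := leqP (lev (e' w)) m; last by have [_ ->] := yP _ wD mw.
  rewrite -(downK p' wm) adj_upl yx -dw -adj_upl downK //.
  by rewrite leqNgt lw -leqNgt.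
Qed.

Lemma linked_sat b m i i' (p : chain m i) (p' : chain m i') psi e e' :
  (forall n, m < n -> b < cap n) -> m < i -> m < i' ->
  (forall v, occurs v psi -> v <= b) -> linked b p p' e e' ->
  sat (M := expand (tower i)) psi e <-> sat (M := expand (tower i')) psi e'.
Proof.
move=> capb mi mi' psib ee'.
refine (@sat_back_forth _ (expand (tower i)) (expand (tower i')) (fun v => v <= b)
  (@linked b m i i' p p') _ _ _ _ psi psib e e' ee').
- move=> f f' ff' v w vb wb; have [_ _ /(_ w wb)[vw _]] := ff' v vb.
  by split=> /eqP; [rewrite vw | rewrite -vw] => /eqP.
- move=> f f' ff' [R|] t tb /=; last first.
    rewrite !tnth_map; have [_ _ /(_ (tnth t ord_max))[]//] := ff' (tnth t ord0) (tb _ (mem_tnth _ _)).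
    exact/tb/mem_tnth.
  have fl v : v \in (t : seq nat) -> (lev (f v) == 0) = (lev (f' v) == 0).
    by move=> /tb /ff'[dv lv _]; apply: lev0_linked dv lv.
  rewrite !all_map; congr andb; first exact: eq_in_all.
  congr interp; apply: val_inj => /=; rewrite -!map_comp; apply/eq_in_map => v /tb /ff'[dv _ _] /=.
  by rewrite -(base_down p) dv base_down.
- by move=> f f' ff' v x vb; apply: linked_forth.
- move=> f f' /linked_sym ff' v y vb; have [x fx] := linked_forth y capb mi vb ff'.
  by exists x; apply: linked_sym.
Qed.

Lemma linked_exists b m i i' (p : chain m i) (p' : chain m i') (e : nat -> tower i) :
  (forall n, m < n -> b < cap n) -> m < i' -> exists e', linked b p p' e e'.
Proof.
move=> capb mi'.
have H c : c <= b.+1 -> exists f f', linked b p p' f f' /\ forall v, v < c -> f v = e v.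
  elim: c => [_|c IH cb].
    (* A constant assignment in level at most [m] is linked to its copy; then the variables receive
       the values of [e] one at a time. *)
    pose z := down p (e 0); exists (fun=> up p z), (fun=> up p' z); split=> // v _.
    by rewrite !upK !lev_up; split=> // w _; rewrite !eqxx !adj_upr !upK.
  have [f [f' [ff' fe]]] := IH (ltnW cb).
  have [y fy] := linked_forth (e c) capb mi' (cb : c <= b) ff'.
  exists [eta f with c |-> e c], [eta f' with c |-> y]; split=> // v.
  rewrite ltnS leq_eqVlt /= => /predU1P[->|vc]; first by rewrite eqxx.
  by rewrite ltn_eqF //; apply: fe.
have [f [f' [ff' fe]]] := H b.+1 (leqnn _).
exists f' => v vb; have [dv lv vP] := ff' v vb.
by rewrite -(fe v vb); split=> // w wb; rewrite -(fe w wb); apply: vP.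
Qed.

(** * Transitive tournaments *)

Lemma tournament_inj (S : stage) b (y : 'I_b.+1 -> S) : tournament y -> injective y.
Proof.
move=> ty v w vw; apply: val_inj; case: (ltngtP v w) => // /ty; rewrite vw; tauto.
Qed.

(* The number of elements of [Y] strictly below a vertex recovers its index. *)
Lemma tournament_uniq (S : stage) b (y y' : 'I_b.+1 -> S) :
  tournament y -> tournament y' ->
  [set y v | v in [set: 'I_b.+1]] = [set y' v | v in [set: 'I_b.+1]] -> y =1 y'.
Proof.
move=> ty ty' yy'.
pose r (Y : {set S}) x := #|[set z in Y | adj z x && ~~ adj x z]|.
have rE (f : 'I_b.+1 -> S) : tournament f ->
    forall w, r [set f v | v in [set: 'I_b.+1]] (f w) = w.
  move=> tf w; rewrite /r.
  have -> : [set z in [set f v | v in [set: 'I_b.+1]] | adj z (f w) && ~~ adj (f w) z]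
      = f @: [set v : 'I_b.+1 | v < w].
    apply/setP => z; rewrite !inE; apply/andP/imsetP => [[/imsetP[v _ ->]]|[v + ->]].
      case/andP=> vw /negP nwv; exists v => //; rewrite inE.
      case: (ltngtP v w) => // [/tf[wv _]|/val_inj vw']; first by case: nwv.
      by case: nwv; move: vw; rewrite vw'.
    by rewrite inE => /tf[-> /negP ->]; rewrite imset_f.
  rewrite card_imset; last exact: tournament_inj.
  rewrite -sum1_card (eq_bigl (fun v : 'I_b.+1 => v < w)); last by move=> v; rewrite inE.
  by rewrite (big_ord_narrow (ltnW (ltn_ord w))) /= sum1_card card_ord.
move=> v; have : y v \in [set y' v | v in [set: 'I_b.+1]] by rewrite -yy' imset_f.
case/imsetP=> w _ vw; rewrite vw; congr y'; apply: val_inj.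
by rewrite /= -(rE y' ty' w) -yy' -vw (rE y ty v).
Qed.

(** The vertices are added one at a time as generic points of level [j], each above its [u v],
    receiving edges from all earlier vertices and sending none back. *)
Lemma tournament_exists j b (u : 'I_b.+1 -> tower j) :
  b < cap j -> (forall v, lev (u v) < j) ->
  exists y : 'I_b.+1 -> tower j, [/\ forall v, lev (y v) = j, tournament y &
    forall v, sim (lev (u v)) (u v) (y v)].
Proof.
move=> bj uj.
have H c : c <= b.+1 -> exists y : 'I_b.+1 -> tower j, forall v : 'I_b.+1, v < c ->
    [/\ lev (y v) = j, sim (lev (u v)) (u v) (y v) &
      forall w : 'I_b.+1, w < v -> adj (y w) (y v) /\ ~ adj (y v) (y w)].
  elim: c => [_|c IH cb]; first by exists u.
  have [y yP] := IH (ltnW cb).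
  pose vc : 'I_b.+1 := Ordinal cb.
  pose D := [set y v | v in [set v : 'I_b.+1 | v < c]].
  have p := chain_le (ltnW (uj vc)).
  have Dj d : d \in D -> lev d = j.
    by case/imsetP=> v; rewrite inE => /yP[vj _ _] ->.
  have uu : lev (down p (u vc)) = lev (u vc) by apply: lev_down.
  have [n ln|z [zj zu _ zP]] := @tower_ext _ _ p D (down p (u vc)) pred0 predT _ uu.
    have [->|nj] := eqVneq n j.
      apply: leq_trans bj; apply: leq_trans (_ : #|D| <= _).
        by apply: subset_leq_card; apply/fintype.subsetP => d; rewrite inE => /andP[].
      apply: leq_trans (leq_imset_card _ _) _.
      by rewrite -[X in _ <= X]card_ord max_card.
    rewrite (_ : [set d in D | _] = finset.set0) ?cards0 //; apply/setP => d; rewrite !inE.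
    by apply/negP => /andP[/Dj ->]; rewrite eq_sym (negPf nj).
  exists (fun v : 'I_b.+1 => if v < c then y v else z) => v.
  rewrite ltnS leq_eqVlt => /predU1P[vc'|vc'].
    have -> : v = vc by apply: val_inj.
    rewrite /= ltnn; split=> //.
      apply/(simP p); rewrite ?zu ?zj //; exact/ltnW.
    move=> w wc; rewrite wc.
    have wD : y w \in D by apply: imset_f; rewrite inE.
    have [|zw wz] := zP _ wD; first by rewrite (Dj _ wD).
    by rewrite zw wz.
  have [vj uv vP] := yP v vc'; rewrite vc'; split=> // w wv.
  by rewrite (ltn_trans wv vc'); apply: vP.
have [y yP] := H b.+1 (leqnn _).
exists y; split=> [v|v w vw|v].
- by have [] := yP v (ltn_ord v).
- by have [_ _] := yP w (ltn_ord w); apply.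
- by have [] := yP v (ltn_ord v).
Qed.

(** * Evaluating formulas through the stored families *)

Hypothesis phi_bnd : forall n v, occurs v (phi n) -> v <= bnd n.

Lemma capb n m : n < m -> bnd n < cap m.
Proof. by move=> nm; apply: leq_trans (bnd_cap (ltnW nm)). Qed.

(** Level and ancestry determine each evaluation point from [y], so every choice of them gives the
    same truth value. *)
Lemma holds_atP j n (r : seq nat) (e : nat -> tower j) (y : 'I_(bnd n).+1 -> tower j) :
  (forall v : 'I_(bnd n).+1, lev (e v) = nth 0 r v) ->
  (forall v : 'I_(bnd n).+1, sim (nth 0 r v) (e v) (y v)) ->
  (forall v, lev (y v) = j) ->
  holds_at r y <-> sat (M := expand (tower j)) (phi n) e.
Proof.
move=> er ey yj; split=> [[e' e'P se']|se]; last by exists e.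
rewrite (@sat_local _ (expand (tower j)) (phi n) e e') // => v /phi_bnd vb.
have := er (inord v); have := ey (inord v); have := e'P (inord v).
rewrite inordK // => -[e'r e'y] ey' er'.
have p : chain (nth 0 r v) j by apply: chain_le; rewrite -er' lev_le.
rewrite -(downK p (x := e v)) ?er' // -(downK p (x := e' v)) ?e'r //; congr up.
apply/simP; rewrite ?er' ?e'r //.
exact: sim_trans ey' (sim_sym e'y).
Qed.

(* The marks of level [j + 1] reveal that the set of the [y v] is not in the stored
   family: otherwise the points [f] could be chosen to exhaust the marks. *)
Definition coded i n (r : seq nat) j (e : 'I_(bnd n).+1 -> tower i) : Prop :=
  exists y : 'I_(bnd n).+1 -> tower i,
    [/\ forall v, lev (y v) = j /\ sim (nth 0 r v) (e v) (y v), tournament y &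
      forall f : 'I_(bnd n).+1 * 'I_(cap j.+1).+1 -> tower i,
        (forall x, lev (f x) = j.+1 /\ sim j (f x) (y x.1)) ->
        exists w, [/\ lev w = j.+1, exists v, sim j w (y v) &
          forall x, adj w (f x) /\ ~ adj (f x) w]].

(** Back-and-forth over level [n] moves the truth value to the truncation [tower j]. There a
    tournament above the points is stored exactly if the formula fails, and the marks of level
    [j.+1] tell whether it is stored. *)
Lemma codedP i j (e : nat -> tower i) :
  (request j).1 < j -> j < i ->
  (forall v : 'I_(bnd (request j).1).+1,
     lev (e v) = nth 0 (request j).2 v /\ nth 0 (request j).2 v < j) ->
  coded (request j).2 j (fun v : 'I_(bnd (request j).1).+1 => e v) <->
  sat (M := expand (tower i)) (phi (request j).1) e.
Proof.
set n := (request j).1; set r := (request j).2 => nj ji er.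
have q := chain_le ji.
have lift_old x : lev x <= j -> exists2 x0 : tower j, x = up q (inl x0) & lev x0 = lev x.
  move=> xj; have := downK q (leqW xj); have := lev_down_low q (leqW xj).
  case: (down q x) => [x0|a] /= lx <-; first by exists x0; rewrite ?lev_up.
  by rewrite -lx ltnn in xj.
have lift_new x : lev x = j.+1 -> exists a, x = up q (inr a).
  move=> xj; have := downK q (x := x); have := lev_down_low q (x := x).
  rewrite xj => /(_ (leqnn _)) + /(_ (leqnn _)).
  case: (down q x) => [x0|a] /= lx <-; last by exists a.
  by have := lev_le x0; rewrite lx ltnn.
have simi k (a b : tower j) : k <= j ->
    sim k (up q (inl a)) (up q (inl b)) <-> sim k a b.
  by move=> kj; rewrite sim_up ?leqW // -(sim_up (ChainS (Chain0 j)) a b kj).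
have adji (a b : tower j) : adj (up q (inl a)) (up q (inl b)) = adj a b.
  by rewrite adj_upr upK.
have simc a (x0 : tower j) : lev x0 = j ->
    sim j (up q (inr a)) (up q (inl x0)) <-> color a = x0.
  by move=> xj; rewrite sim_up // (simP (ChainS (Chain0 j))) //= xj.
have /choice[e0 e0P] : forall v, exists x0 : tower j,
    v <= bnd n -> e v = up q (inl x0) /\ lev x0 = lev (e v).
  move=> v; case: (leqP v (bnd n)) => [vb|_]; last by exists (down (chain_le (ltnW ji)) (e v)).
  have := er (inord v); rewrite inordK // => -[ev rv].
  by have [|x0 ? ?] := lift_old (e v); [rewrite ev ltnW | exists x0].
have er0 (v : 'I_(bnd n).+1) : e v = up q (inl (e0 v)) /\ lev (e0 v) = nth 0 r v.
  by have [ev l0] := e0P v (ltn_ord v); split; rewrite // l0; have [] := er v.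
have satE : sat (M := expand (tower i)) (phi n) e <->
    sat (M := expand (tower j)) (phi n) e0.
  pose p : chain n j := chain_le (ltnW nj).
  apply: (@linked_sat (bnd n) n i j (chain_trans (ChainS p) q) p (phi n) e e0).
  - by move=> m /capb.
  - exact: ltn_trans ji.
  - by [].
  - exact: phi_bnd.
  - move=> v vb; have [-> l0] := e0P v vb.
    rewrite down_trans upK lev_up /=; split=> // w wb; have [-> _] := e0P w wb.
    by rewrite (inj_eq (can_inj (upK q))) adji.
set F := family (tower j) j n r.
have FE (y : 'I_(bnd n).+1 -> tower j) : (forall v, lev (y v) = j) ->
    (forall v : 'I_(bnd n).+1, sim (nth 0 r v) (e0 v) (y v)) -> tournament y ->
    [set y v | v in [set: 'I_(bnd n).+1]] \in F <-> ~ sat (M := expand (tower j)) (phi n) e0.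
  move=> yj ey ty.
  rewrite -(@holds_atP j n r e0 y) //; last by move=> v; have [] := er0 v.
  rewrite inE; split=> [/asboolP[y' [yy' _ ty' ny']]|ny]; last by apply/asboolP; exists y.
  by have -> : y = y' by apply: funext; apply: tournament_uniq.
rewrite satE; split=> [[y [yj ty fP]]|se].
- have /choice[y0 y0P] : forall v, exists x0 : tower j, y v = up q (inl x0) /\ lev x0 = j.
    move=> v; have [|x0 ? x0j] := lift_old (y v); first by rewrite (yj v).1.
    by exists x0; rewrite x0j (yj v).1.
  apply: contrapT; rewrite -(FE y0) => [YF|v|v|v w vw]; last 3 first.
  + by have [] := y0P v.
  + have [_] := yj v; have [-> _] := y0P v; have [-> _] := er0 v.
    by rewrite simi // ltnW //; have [] := er v.
  + by have := ty v w vw; have [-> _] := y0P v; have [-> _] := y0P w; rewrite !adji.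
  (* If the formula failed, the set of vertices would be stored, and points exhausting the marks
     would admit no [w]. *)
  have [|v|f0 [f0c f0P]] := @step_code_mem (tower j) j (cap j.+1) (bnd n) F _ y0 YF.
  + by move=> v; have [] := y0P v.
  + exact: imset_f.
  have [x|w [wj [v wv] wf]] := fP (fun x => up q (inr (f0 x))).
    split; first by rewrite lev_up.
    by have [-> yj0] := y0P x.1; rewrite simc.
  have [w0 w0E] := lift_new w wj; subst w.
  have [|x xP] := f0P w0.
    by move: wv; have [-> yj0] := y0P v; rewrite simc // => ->; apply: imset_f.
  by apply: xP; have := wf x; rewrite !adj_upr !upK.
- have [||y0 [y0j ty0 y0s]] := @tournament_exists j (bnd n) (fun v => e0 v).
  + exact: capb.
  + by move=> v; have [_ ->] := er0 v; have [] := er v.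
  have {}y0s (v : 'I_(bnd n).+1) : sim (nth 0 r v) (e0 v) (y0 v).
    by rewrite -(er0 v).2; apply: y0s.
  exists (fun v => up q (inl (y0 v))); split.
  + move=> v; rewrite lev_up /= y0j; split=> //; have [-> _] := er0 v.
    by rewrite simi // ltnW //; have [] := er v.
  + by move=> v w /ty0; rewrite !adji.
  move=> f fP.
  have /choice[f0 f0P] : forall x, exists a, f x = up q (inr a).
    by move=> x; apply: lift_new; have [] := fP x.
  have f0c x : color (f0 x) = y0 x.1.
    by have [_] := fP x; rewrite f0P simc.
  have [Y YF|w [wc wP]] := @step_code_notin (tower j) j (cap j.+1) (bnd n) F
    y0 (y0 ord0) f0 _ (y0j ord0) f0c.
  (* A stored set containing all [y0 v] has no more elements than they are, hence equals the set of
     them; but then the formula would fail. *)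
  + apply: contrapT => /forallNP yY.
    have [y1 [Y1 _ ty1 _]] : exists y1 : 'I_(bnd n).+1 -> tower j,
        [/\ Y = [set y1 v | v in [set: 'I_(bnd n).+1]], (forall v, lev (y1 v) = j),
        tournament y1 & ~ holds_at r y1] by move: YF; rewrite inE => /asboolP.
    suff YE : [set y0 v | v in [set: 'I_(bnd n).+1]] = Y.
      by move: YF; rewrite -YE FE.
    apply/eqP; rewrite eqEcard; apply/andP; split.
      by apply/fintype.subsetP => _ /imsetP[v _ ->]; apply: contrapT => /negP /yY.
    by rewrite Y1 !card_imset //; apply: tournament_inj.
  exists (up q (inr w)); split.
  + by rewrite lev_up.
  + by exists ord0; rewrite simc.
  + by move=> x; rewrite f0P !adj_upr !upK; apply: wP.
Qed.

Lemma coded_sat i n (r : seq nat) j (e : nat -> tower i) :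
  request j = (n, r) -> n < j -> j < i ->
  (forall v : 'I_(bnd n).+1, lev (e v) = nth 0 r v /\ nth 0 r v < j) ->
  coded r j (fun v : 'I_(bnd n).+1 => e v) <->
  sat (M := expand (tower i)) (phi n) e.
Proof. by move=> req; have := @codedP i j e; rewrite req. Qed.

(** The points may lie in arbitrarily high levels, so they are replaced by [d] of levels at most
    [n.+1] with the same ancestors in level [n] and the same pattern. Finitely many level lists [r]
    remain, each with its own request [jr r]. *)
Lemma truth_coded i n (jr : {ffun 'I_(bnd n).+1 -> 'I_n.+2} -> nat)
    (e : 'I_(bnd n).+1 -> tower i) :
  (forall r, [/\ request (jr r) = (n, [seq val (r v) | v <- enum 'I_(bnd n).+1]),
     n.+1 < jr r & jr r < i]) ->
  sat (M := expand (tower i)) (phi n) (fun v => e (inord v)) <->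
  exists d : 'I_(bnd n).+1 -> tower i,
    [/\ forall v, lev (e v) <= n /\ e v = d v \/
          [/\ n < lev (e v), n < lev (d v) & sim n (e v) (d v)],
        forall v w, (e v = e w <-> d v = d w) /\ (adj (e v) (e w) <-> adj (d v) (d w)) &
        exists r : {ffun 'I_(bnd n).+1 -> 'I_n.+2},
          (forall v, lev (d v) = r v) /\
          coded [seq val (r v) | v <- enum 'I_(bnd n).+1] (jr r) d].
Proof.
move=> jrP.
have ni : n.+1 < i by have [_ nj ji] := jrP [ffun=> ord0]; apply: ltn_trans ji.
pose p' : chain n n.+1 := ChainS (Chain0 n).
have q : chain n.+1 i := chain_le (ltnW ni).
pose p := chain_trans p' q.
have nthr (r : {ffun 'I_(bnd n).+1 -> 'I_n.+2}) (v : 'I_(bnd n).+1) :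
    nth 0 [seq val (r v) | v <- enum 'I_(bnd n).+1] v = r v.
  by rewrite (nth_map v) ?size_enum_ord // nth_ord_enum.
have cP (d : 'I_(bnd n).+1 -> tower i) (r : {ffun 'I_(bnd n).+1 -> 'I_n.+2}) :
    (forall v, lev (d v) = r v) ->
    coded [seq val (r v) | v <- enum 'I_(bnd n).+1] (jr r) d <->
    sat (M := expand (tower i)) (phi n) (fun v => d (inord v)).
  move=> dr; have [req nj ji] := jrP r.
  rewrite -(coded_sat req (ltnW nj) ji).
    by rewrite (_ : (fun v : 'I_(bnd n).+1 => d (inord v)) = d) //; apply: funext => v; rewrite inord_val.
  by move=> v; rewrite inord_val nthr dr; split=> //; apply: leq_ltn_trans nj; rewrite -ltnS.
have inb (v : 'I_(bnd n).+1) : v <= bnd n by rewrite -ltnS.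
have edP (d : 'I_(bnd n).+1 -> tower i) :
    (forall v, lev (e v) <= n /\ e v = d v \/
       [/\ n < lev (e v), n < lev (d v) & sim n (e v) (d v)]) ->
    (forall v w, (e v = e w <-> d v = d w) /\ (adj (e v) (e w) <-> adj (d v) (d w))) ->
    sat (M := expand (tower i)) (phi n) (fun v => e (inord v)) <->
    sat (M := expand (tower i)) (phi n) (fun v => d (inord v)).
  move=> ed edw; apply: (@linked_sat (bnd n) n i i p p) => //.
  - by move=> m /capb.
  - exact: ltnW.
  - exact: ltnW.
  - exact: phi_bnd.
  move=> v _.
  have vP w : w <= bnd n ->
      (e (inord v) == e (inord w)) = (d (inord v) == d (inord w)) /\
      adj (e (inord v)) (e (inord w)) = adj (d (inord v)) (d (inord w)).
    move=> _; have [vw avw] := edw (inord v) (inord w).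
    by split; [apply/eqP/eqP => ?; apply/vw | apply/idP/idP => ?; apply/avw].
  have [[en ev]|[ne nd sed]] := ed (inord v); split=> //.
  - by rewrite ev.
  - by rewrite ev.
  - by apply/(simP p) => //; exact: ltnW.
  - by rewrite ne nd.
split=> [se|[d [ed edw [r [dr /(cP d r dr) sd]]]]]; last exact/(edP d ed edw).
(* Going to [tower n.+1] by back-and-forth and returning along [up] bounds the levels by [n.+1]. *)
have [e0 ee0] := linked_exists (b := bnd n) p p' (fun v => e (inord v)) (@capb n) (ltnSn n).
pose d (v : 'I_(bnd n).+1) := up q (e0 v).
have ed v : lev (e v) <= n /\ e v = d v \/
     [/\ n < lev (e v), n < lev (d v) & sim n (e v) (d v)].
  have [] := ee0 v (inb v); rewrite inord_val => de le _.
  have [en|ne] := leqP (lev (e v)) n.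
    left; split=> //; rewrite -(downK p en) de.
    have e0n : lev (e0 v) <= n by rewrite leqNgt -le -leqNgt.
    by rewrite /p up_trans downK.
  have nd : n < lev (d v) by rewrite lev_up -le.
  right; split=> //; apply/(simP p); rewrite ?(ltnW ne) ?(ltnW nd) //.
  by rewrite de /p down_trans upK.
have edw v w : (e v = e w <-> d v = d w) /\ (adj (e v) (e w) <-> adj (d v) (d w)).
  have [_ _ /(_ w (inb w))] := ee0 v (inb v); rewrite !inord_val => -[vw avw].
  rewrite avw /d adj_upr upK; split=> //.
  split=> [/eqP|/(can_inj (upK q))/eqP]; first by rewrite vw => /eqP ->.
  by rewrite -vw => /eqP.
exists d; split=> //; exists [ffun v : 'I_(bnd n).+1 => inord (lev (e0 v))].
have dr v : lev (d v) = [ffun v : 'I_(bnd n).+1 => inord (lev (e0 v)) : 'I_n.+2] v.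
  by rewrite lev_up ffunE inordK // ltnS lev_le.
by split=> //; apply/(cP _ _ dr)/(edP d ed edw).
Qed.

End Tower.

(** * First-order definability in the tower *)

Section TowerDefinability.
Variables (tau : vocabulary) (phi : nat -> formula (add_binary tau)) (bnd : nat -> nat).
Variables (I : Type) (Nn : I -> structure tau) (ht : I -> nat) (h : nat).
Hypothesis h_ht : forall x, h <= ht x.

(** One formula has to serve all bases and all heights from [h] on, so definability is taken over a
    family of such towers. *)
Let T (x : I) : stage (Nn x) := tower (Nn x) phi bnd (ht x).
Let S (x : I) : structure (add_binary tau) := expand (T x).

Lemma definable_adj (X : finType) (x y : X) :
  definable (S := S) (fun k (e : X -> T k) => adj (e x) (e y)).
Proof.
have := @definable_rel _ I S X (None : add_binary tau) [tuple x; y].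
by apply: definable_ext => k e /=; rewrite !tnth_map !(tnth_nth x).
Qed.

Lemma definable_lev_above l (X : finType) (x : X) :
  (forall j, j <= l -> definable (S := S) (fun k (e : X -> T k) => lev (e x) = j)) ->
  definable (S := S) (fun k (e : X -> T k) => l < lev (e x)).
Proof.
move=> dlev.
apply: (@definable_ext _ I S X (fun k (e : X -> T k) => ~ exists j : 'I_l.+1, lev (e x) = j)).
  move=> k e; split=> [ne|le [j ej]]; last by rewrite ej ltnNge -ltnS ltn_ord in le.
  rewrite ltnNge; apply/negP => el; apply: ne.
  by exists (Ordinal (el : lev (e x) < l.+1)).
apply: definable_not; apply: (@definable_exists _ I S X 'I_l.+1
  (fun j k (e : X -> T k) => lev (e x) = j)) => j.
by apply: dlev; rewrite -ltnS.
Qed.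

(** Level 0 consists of the points with loops; [levelP] defines level [l.+1] from the levels up to
    [l]. *)
Lemma definable_lev l (X : finType) (x : X) : l <= h ->
  definable (S := S) (fun k (e : X -> T k) => lev (e x) = l).
Proof.
elim/ltn_ind: l X x => -[|l] IH X x lh.
  apply: (@definable_ext _ I S X (fun k (e : X -> T k) => adj (e x) (e x))).
    by move=> k e; rewrite adj_refl; split=> /eqP.
  exact: definable_adj.
have dgt (Y : finType) (y : Y) : definable (S := S) (fun k (e : Y -> T k) => l < lev (e y)).
  by apply: definable_lev_above => j jl; apply: IH; [|exact: leq_trans jl (ltnW lh)].
apply: (@definable_ext _ I S X (fun k (e : X -> T k) => l < lev (e x) /\
    exists C : 'I_(cap bnd l.+1).+1 -> T k,
      (forall j, l < lev (C j)) /\ ((exists j, C j = e x) /\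
      forall w : unit -> T k, l < lev (w tt) ->
        exists j, ~ (adj (w tt) (C j) /\ adj (C j) (w tt))))).
  move=> k e; rewrite (levelP (e x) (leq_trans lh (h_ht k))).
  split=> -[lx [C]].
    case=> lC [Cx wC]; split=> //; exists C; split=> // w lw.
    exact: (wC (fun=> w)).
  by case=> lC Cx wC; split=> //; exists C; split=> //; split=> // w; apply: wC.
apply: definable_and; first exact: dgt.
apply: definable_ex; apply: definable_and.
  by apply: definable_forall => j; apply: dgt.
apply: definable_and.
  by apply: definable_exists => j; apply: definable_eq.
apply: definable_all; apply: definable_imp; first exact: dgt.
apply: definable_exists => j; apply: definable_not.
by apply: definable_and; apply: definable_adj.
Qed.

Lemma definable_lev_gt l (X : finType) (x : X) : l <= h ->
  definable (S := S) (fun k (e : X -> T k) => l < lev (e x)).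
Proof.
move=> lh; apply: definable_lev_above => j jl.
exact/definable_lev/(leq_trans jl).
Qed.

Lemma definable_sim l (X : finType) (x y : X) : l <= h ->
  definable (S := S) (fun k (e : X -> T k) => sim l (e x) (e y)).
Proof.
move=> lh; apply: (@definable_ext _ I S X (fun k (e : X -> T k) =>
    forall w : unit -> T k, lev (w tt) = l -> (adj (e x) (w tt) <-> adj (e y) (w tt)))).
  move=> k e; split=> s w wl; last by rewrite s.
  by apply/idP/idP; apply (s (fun=> w)).
apply: definable_all; apply: definable_imp; first exact: definable_lev.
by apply: definable_iff; apply: definable_adj.
Qed.

Lemma definable_coded n (r : seq nat) j (X : finType) (x : 'I_(bnd n).+1 -> X) :
  j < h -> (forall v : 'I_(bnd n).+1, nth 0 r v <= j) ->
  definable (S := S) (fun k (e : X -> T k) => coded r j (fun v => e (x v))).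
Proof.
move=> jh rj; apply: (@definable_ext _ I S X (fun k (e : X -> T k) =>
    exists y : 'I_(bnd n).+1 -> T k,
      (forall v, lev (y v) = j /\ sim (nth 0 r v) (e (x v)) (y v)) /\
      ((forall v w : 'I_(bnd n).+1, v < w -> adj (y v) (y w) /\ ~ adj (y w) (y v)) /\
      forall f : 'I_(bnd n).+1 * 'I_(cap bnd j.+1).+1 -> T k,
        (forall z, lev (f z) = j.+1 /\ sim j (f z) (y z.1)) ->
        exists w : unit -> T k, lev (w tt) = j.+1 /\ ((exists v, sim j (w tt) (y v)) /\
          forall z, adj (w tt) (f z) /\ ~ adj (f z) (w tt))))).
  move=> k e; split=> -[y].
    case=> yj [ty fP]; exists y; split=> // f /fP[w [wj [wy wf]]].
    by exists (w tt).
  case=> yj ty fP; exists y; split=> //; split=> // f /fP[w [wj wy wf]].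
  by exists (fun=> w).
apply: definable_ex; apply: definable_and.
  apply: definable_forall => v; apply: definable_and.
    exact/definable_lev/ltnW.
  by apply: definable_sim; apply: leq_trans (rj v) (ltnW jh).
apply: definable_and.
  apply: definable_forall => v; apply: definable_forall => w.
  case: (ltnP v w) => vw; last first.
    apply: (@definable_ext _ I S _ (fun k (e : X + 'I_(bnd n).+1 -> T k) => e (inr v) = e (inr v))) => //.
    exact: definable_eq.
  apply: (@definable_ext _ I S _ (fun k (e : X + 'I_(bnd n).+1 -> T k) =>
     adj (e (inr v)) (e (inr w)) /\ ~ adj (e (inr w)) (e (inr v)))).
    by move=> k e; split=> [? _|]; last exact.
  by apply: definable_and; [|apply: definable_not]; apply: definable_adj.
apply: definable_all; apply: definable_imp.
  apply: definable_forall => z; apply: definable_and; first exact: definable_lev.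
  exact/definable_sim/ltnW.
apply: definable_ex; apply: definable_and; first exact: definable_lev.
apply: definable_and.
  by apply: definable_exists => v; apply/definable_sim/ltnW.
apply: definable_forall => z.
by apply: definable_and; [|apply: definable_not]; apply: definable_adj.
Qed.

Hypothesis phi_bnd : forall n v, occurs v (phi n) -> v <= bnd n.

Lemma definable_truth n (jr : {ffun 'I_(bnd n).+1 -> 'I_n.+2} -> nat) :
  (forall r, [/\ request (jr r) = (n, [seq val (r v) | v <- enum 'I_(bnd n).+1]),
     n.+1 < jr r & jr r < h]) ->
  definable (S := S) (fun k (e : 'I_(bnd n).+1 -> T k) =>
    sat (M := S k) (phi n) (fun v => e (inord v))).
Proof.
move=> jrP; have nh : n.+1 < h.
  by have [_ nj jh] := jrP [ffun=> ord0]; apply: ltn_trans jh.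
have nh' := ltnW (ltnW nh).
apply: (@definable_ext _ I S _ (fun k (e : 'I_(bnd n).+1 -> T k) =>
  exists d : 'I_(bnd n).+1 -> T k,
    (forall v, lev (e v) <= n /\ e v = d v \/
          n < lev (e v) /\ n < lev (d v) /\ sim n (e v) (d v)) /\
    ((forall v w, (e v = e w <-> d v = d w) /\ (adj (e v) (e w) <-> adj (d v) (d w))) /\
        exists r : {ffun 'I_(bnd n).+1 -> 'I_n.+2},
          (forall v, lev (d v) = r v) /\
          coded [seq val (r v) | v <- enum 'I_(bnd n).+1] (jr r) d))).
  move=> k e; rewrite (@truth_coded _ (Nn k) phi bnd phi_bnd (ht k) n jr e); last first.
    by move=> r; have [? ? ?] := jrP r; split=> //; apply: leq_trans (h_ht k).
  split=> -[d].
    case=> ed [edw dr]; exists d; split=> // v.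
    by case: (ed v) => [|[? []]]; [left | right].
  case=> ed edw dr; exists d; split=> // v.
  by case: (ed v) => [|[? ? ?]]; [left | right].
apply: definable_ex; apply: definable_and.
  apply: definable_forall => v; apply: definable_or.
    apply: definable_and; last exact: definable_eq.
    apply: (@definable_ext _ I S _ (fun k (e : 'I_(bnd n).+1 + 'I_(bnd n).+1 -> T k) =>
      ~ n < lev (e (inl v)))).
      move=> k e; split=> [/negP|en]; first by rewrite -leqNgt.
      by apply/negP; rewrite -leqNgt.
    exact/definable_not/definable_lev_gt.
  apply: definable_and; first exact: definable_lev_gt.
  by apply: definable_and; [apply: definable_lev_gt | apply: definable_sim].
apply: definable_and.
  apply: definable_forall => v; apply: definable_forall => w.
  apply: definable_and; apply: definable_iff;
    by [apply: definable_eq | apply: definable_adj].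
apply: definable_exists => r; have [_ nj jh] := jrP r; apply: definable_and.
  apply: definable_forall => v; apply: definable_lev.
  by apply: leq_trans (ltnW nh); rewrite -ltnS.
apply: (@definable_coded n _ _ _ inr) => // v.
rewrite (nth_map v) ?size_enum_ord // nth_ord_enum.
exact: leq_trans (ltn_ord (r v) : r v <= n.+1) (ltnW nj).
Qed.

End TowerDefinability.

(** * The class of towers *)

Lemma isomorphic_card (tau : vocabulary) (M N : structure tau) :
  isomorphic M N -> #|M| = #|N|.
Proof. by move=> [f [/bij_eq_card]]. Qed.

Definition loops (tau : vocabulary) (M : structure (add_binary tau)) : structure tau :=
  reduct (substructure [set x : M | holdsP x x]).

Lemma isomorphic_loops (tau : vocabulary) (M M' : structure (add_binary tau)) :
  isomorphic M M' -> isomorphic (loops M) (loops M').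
Proof.
move=> [f [[g fK gK] fR]].
have fP x : holdsP (f x) (f x) = holdsP x x.
  by rewrite /holdsP -fR; congr interp; apply: val_inj.
have pf (x : loops M) : f (val x) \in [set y : M' | holdsP y y].
  by have := valP x; rewrite !inE fP.
have pg (y : loops M') : g (val y) \in [set x : M | holdsP x x].
  by have := valP y; rewrite !inE -fP gK.
exists (fun x => exist _ (f (val x)) (pf x)); split.
  exists (fun y => exist _ (g (val y)) (pg y)) => x; apply: val_inj => /=.
    exact: fK.
  exact: gK.
move=> R t /=.
have := fR (Some R) (map_tuple val t) => /= <-.
by congr (interp M' (Some R : add_binary tau)); apply: val_inj => /=; rewrite -!map_comp.
Qed.

(** Exactly the points of level 0 have loops, and [base] maps these bijectively onto [N]. *)
Lemma isomorphic_tower (tau : vocabulary) (N : structure tau)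
    (phi : nat -> formula (add_binary tau)) (bnd : nat -> nat) (i : nat) :
  isomorphic (loops (expand (tower N phi bnd i))) N.
Proof.
set T := tower N phi bnd i.
have loopE (x : T) : @holdsP _ (expand T) x x = (lev x == 0) by rewrite -adj_refl.
pose p : chain 0 i := chain_le (leq0n i).
have pu (x : N) : (up (phi := phi) (bnd := bnd) p x : expand T)
    \in [set y : expand T | holdsP y y].
  by rewrite inE loopE lev_up.
exists (fun x => @base _ _ T (val x)); split.
  pose u (x : N) : loops (expand T) :=
    exist (fun y => y \in [set y : expand T | holdsP y y]) _ (pu x).
  exists u => x.
    apply: val_inj; have := valP x; rewrite inE loopE => /eqP x0.
    by rewrite /= -(base_down p) (downK p) ?x0.
  by rewrite /= -(base_down p) (upK p).
move=> R t /=.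
rewrite (_ : all _ _ = true) /=.
  by congr interp; apply: val_inj => /=; rewrite -map_comp.
by apply/allP => _ /mapP[x _ ->]; rewrite -loopE; have := valP x; rewrite inE.
Qed.

Lemma first_order_card (tau : vocabulary) (s : nat) :
  exists2 chi, first_order chi &
    forall (M : structure tau) (e : nat -> M), sat chi e <-> #|M| <= s.
Proof.
have [|chi chiF chiE] := (_ : definable (S := fun M : structure tau => M)
  (X := void) (fun M e => exists d : 'I_s -> M, forall w : unit -> M,
    exists j, d j = w tt)) (fun _ => 0).
  apply: definable_ex; apply: definable_all; apply: definable_exists => j.
  exact: definable_eq.
exists chi => // M e; rewrite chiE; split=> [[d dP]|Ms].
  rewrite -[s]card_ord -!cardsT; apply: leq_trans (leq_imset_card d _).
  apply: subset_leq_card; apply/fintype.subsetP => x _.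
  by have [j jx] := dP (fun=> x); apply/imsetP; exists j.
exists (fun j => nth (e 0) (enum M) j) => w.
have lw : index (w tt) (enum M) < s by apply: leq_trans Ms; rewrite cardE index_mem mem_enum.
by exists (Ordinal lw); rewrite /= nth_index // mem_enum.
Qed.

Lemma request_exists (n : nat) (r : seq nat) (m : nat) :
  exists2 j, request j = (n, r) & m < j.
Proof.
pose g (k : nat) := pickle ((n, r, k) : nat * seq nat * nat).
have ginj : injective g by move=> k k' /(pcan_inj pickleK)[].
suff [k mk] : exists k, m < g k.
  by exists (g k); rewrite // /request /g pickleK.
apply: contrapT => /forallNP H.
have gm (k : 'I_m.+2) : g k < m.+1 by rewrite ltnS leqNgt; apply/negP/H.
have : injective (fun k => Ordinal (gm k)).
  by move=> k k' /(congr1 val) /= /ginj /val_inj.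
by move=> /leq_card; rewrite !card_ord ltnn.
Qed.

(** [h] exceeds one suitable request for each level list of [phi n], so it depends neither on the
    base nor on the height. *)
Lemma definable_in_tower (tau : vocabulary) (phi : nat -> formula (add_binary tau))
    (bnd : nat -> nat) (n : nat) :
  (forall n v, occurs v (phi n) -> v <= bnd n) ->
  exists h, exists2 chi, first_order chi &
    forall (N : structure tau) (i : nat), h <= i ->
    forall e : nat -> expand (tower N phi bnd i), sat (phi n) e <-> sat chi e.
Proof.
move=> phi_bnd.
have /choice[jr jrP] : forall r : {ffun 'I_(bnd n).+1 -> 'I_n.+2}, exists j,
    request j = (n, [seq val (r v) | v <- enum 'I_(bnd n).+1]) /\ n.+1 < j.
  move=> r; have [j ? ?] := request_exists n [seq val (r v) | v <- enum 'I_(bnd n).+1] n.+1.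
  by exists j.
pose h := (\max_r jr r).+1; exists h.
pose I := {x : structure tau * nat | h <= x.2}.
have [|r|chi chiF chiE] := @definable_truth tau phi bnd I (fun x => (sval x).1)
    (fun x => (sval x).2) h _ phi_bnd n jr _ val.
- by move=> x; apply: (svalP x).
- by have [? ?] := jrP r; split=> //; rewrite ltnS; apply: leq_bigmax.
exists chi => // N i hi e.
have := chiE (exist (fun x : structure tau * nat => h <= x.2) (N, i) hi) e => /= ->.
by apply: sat_local => v /phi_bnd vb; rewrite /= inordK.
Qed.

From mathcomp Require Import classical_sets functions cardinality.

(** Numbers not taken by the injection on [L] get a trivial formula; [bnd] is the largest variable
    of a finite set. *)
Lemma enumerate_formulas (tau : vocabulary) (L : set (formula tau)) :
  (forall psi, L psi -> finite_variable psi) -> countable L ->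
  exists (phi : nat -> formula tau) (bnd : nat -> nat),
    (forall n v, occurs v (phi n) -> v <= bnd n) /\
    (forall psi, L psi -> exists n, phi n = psi).
Proof.
move=> Lfin /countable_injP[f finj].
have /choice[phi phiP] : forall n, exists psi, finite_variable psi /\
    forall psi', L psi' -> f psi' = n -> psi = psi'.
  move=> n; have [[psi [Lpsi fpsi]]|nL] := pselect (exists psi, L psi /\ f psi = n).
    exists psi; split; first exact: Lfin.
    by move=> psi' Lpsi' fpsi'; apply: finj; rewrite ?inE // fpsi.
  exists (FEq tau 0 0); split; last by move=> psi Lpsi fpsi; case: nL; exists psi.
  apply/finite_seqP; exists [:: 0]; apply/seteqP; split=> v /=; rewrite inE.
    by case=> ->.
  by move=> /eqP ->; left.
have /choice[bnd bndP] : forall n, exists b, forall v, occurs v (phi n) -> v <= b.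
  move=> n; have [/finite_seqP[s sE] _] := phiP n.
  exists (\max_(v <- s) v) => v vphi; apply: leq_bigmax_seq => //.
  by move/seteqP: sE => -[/(_ v vphi)].
exists phi, bnd; split=> // psi Lpsi; exists (f psi).
by have [_ /(_ psi Lpsi erefl)] := phiP (f psi).
Qed.

Theorem theorem4p1 (tau1 : vocabulary) (K1 : structure tau1 -> Prop)
    (L : set (formula (add_binary tau1))) :
  structure_class K1 ->
  (forall phi, L phi -> finite_variable phi) ->
  countable L ->
  exists K2 : structure (add_binary tau1) -> Prop,
    structure_class K2 /\
    (forall N : structure tau1,
       K1 N <->
       exists M : structure (add_binary tau1), K2 M /\
         isomorphic (reduct (substructure [set x : M | holdsP x x])) N) /\
    (forall phi, L phi ->
       exists chi, first_order chi /\ equivalent_on K2 phi chi).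
Proof.
move=> [K1pos K1iso] Lfin Lcount.
have [phi [bnd [phi_bnd phiL]]] := enumerate_formulas Lfin Lcount.
(* Finite structures have countably many isomorphism types; the tower over code [c] has height
   [pickle c], so each height occurs at most once. *)
pose C : countType := {n : nat & code tau1 n}.
pose base_of (c : C) : structure tau1 := decode (tagged c).
pose ext (c : C) := expand (tower (base_of c) phi bnd (pickle c)).
exists (fun M => exists2 c, K1 (base_of c) & isomorphic (ext c) M).
split; [split=> [M|M M' MM']|split].
- move=> [c Kc /isomorphic_card <-]; have /card_gt0P[x _] := K1pos _ Kc.
  by apply/card_gt0P; exists (up (chain_le (leq0n (pickle c))) x).
- by move=> [c Kc cM]; exists c => //; apply: isomorphic_trans MM'.
- move=> N; split=> [KN|[M [[c Kc cM] MN]]].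
    have [c cN] := isomorphic_decode N.
    pose c' : C := Tagged (code tau1) c.
    exists (ext c'); split; last first.
      exact: isomorphic_trans (isomorphic_tower _ _ _ _) cN.
    exists c'; last by exists id; split; [exists id | move=> R t; congr interp; apply: val_inj; rewrite /= map_id].
    exact: K1iso (isomorphic_sym cN) KN.
  apply: K1iso Kc; apply: isomorphic_trans (isomorphic_sym (isomorphic_tower _ _ _ _)) _.
  exact: isomorphic_trans (isomorphic_loops cM) MN.
move=> _ /phiL[n <-].
have [h [chi1 chi1F chi1P]] := @definable_in_tower tau1 phi bnd n phi_bnd.
(* [s] bounds the sizes of the finitely many towers lower than [h]; a larger structure of the class
   has height at least [h], where [chi1] applies. *)
pose s := \sum_(k < h) (if @unpickle C k is Some c then #|ext c| else 0).
have [chi2 chi2F chi2P] := first_order_bounded s (phi_bnd n).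
have [sml smlF smlP] := first_order_card (add_binary tau1) s.
exists (FOr (FAnd sml chi2) (FAnd (FNot sml) chi1)); split=> //.
move=> M [c Kc cM] e /=; rewrite smlP.
have [Ms|Ms] := leqP #|M| s.
  by rewrite (chi2P _ _ Ms); split=> [se|[[]|[]]] //; left.
have hc : h <= pickle c.
  rewrite leqNgt; apply/negP => ch; move: Ms.
  rewrite -(isomorphic_card cM) /s (bigD1 (Ordinal ch)) //= pickleK.
  by rewrite ltnNge leq_addr.
have [f [fbij fR]] := isomorphic_sym cM.
rewrite !(sat_iso fbij fR) (chi1P _ _ hc).
by split=> [se|[[]|[]]] //; right.
Qed.
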